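(* In the theory of three groups $\mathsf{3G}$, every first-order formula of the language $\langle Z,L,+,0,1,{<}\rangle$ is equivalent (provably in $\mathsf{3G}$) to a special formula.
   Context: All groups are abelian and all orders are total. An integer part of an ordered group $G$ is a subgroup $Z\subseteq G$ having a least positive element $1$, such that every $x\in G$ satisfies $|x-n|\le1$ for some $n\in Z$; then for every $x\in G$ there is a unique $\lfloor x\rfloor\in Z$ with $\lfloor x\rfloor\le x<\lfloor x\rfloor+1$, and $\{x\}:=x-\lfloor x\rfloor$. The theory of three groups $\mathsf{3G}$ is the first-order theory in the language $\langle Z,L,+,0,1,<\rangle$, where $Z$ and $L$ are unary predicates (also treated as sets) and the whole universe is denoted $Q$, with axioms: (i) $\langle Q,+,0,<\rangle$ is a divisible ordered group; (ii) $Z$ is an integer part of $Q$ with least positive element $1$; (iii) $L$ is a convex subgroup of $Q$ containing $1$. An integer $n\in\mathbb Z$ also denotes the element $n\cdot1$ of $Q$, and for $m\in\mathbb N_{>0}$, $x\equiv y\pmod m$ means $x-y\in mZ$. A special formula is a Boolean combination of formulas of the forms $$\textstyle\sum_in_i\{x_i\}\ge n,\qquad\sum_in_i\lfloor x_i\rfloor\ge n,\qquad\lfloor x_i\rfloor\equiv k\pmod m,\qquad\sum_in_ix_i\in L,\qquad Q=L,$$ where the sums are finite, the $x_i$ are variables, $n_i,n,k,m\in\mathbb Z$, $0\le k<m$, and $Q=L$ stands for the sentence $\forall x\,L(x)$. *)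

(* Defs.v *)
From HB Require Import structures.
From mathcomp Require Import all_boot ssrint.

Set Implicit Arguments.
Unset Strict Implicit.
Unset Printing Implicit Defensive.

(* First-order logic with equality over the signature <Z, L, +, 0, 1, <>, with
   de Bruijn indices: [Var n] refers to the n-th enclosing [All], and, once
   these are exhausted, to a free variable.  The primitive connectives are
   falsity, implication and universal quantification; the others are the usual
   classical abbreviations. *)

Inductive term : Type :=
  | Var of nat
  | Zero
  | One
  | Add of term & term.

Inductive form : Type :=
  | Eq of term & term
  | Lt of term & term
  | InZ of term
  | InL of term
  | Bot
  | Imp of form & form
  | All of form.

Definition term_eq_dec (s t : term) : decidable (s = t).
Proof. by rewrite /decidable; do !decide equality. Defined.

Definition form_eq_dec (p q : form) : decidable (p = q).
Proof. by rewrite /decidable; do !decide equality. Defined.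

HB.instance Definition _ := hasDecEq.Build term (compareP term_eq_dec).
HB.instance Definition _ := hasDecEq.Build form (compareP form_eq_dec).

Declare Scope fo_scope.
Delimit Scope fo_scope with fo.

Definition Not (p : form) : form := Imp p Bot.
Definition And (p q : form) : form := Not (Imp p (Not q)).
Definition Or (p q : form) : form := Imp (Not p) q.
Definition Iff (p q : form) : form := And (Imp p q) (Imp q p).
Definition Ex (p : form) : form := Not (All (Not p)).
Definition Le (s t : term) : form := Or (Lt s t) (Eq s t).

Notation "0" := Zero : fo_scope.
Notation "1" := One : fo_scope.
Notation "s + t" := (Add s t) : fo_scope.
Notation "s == t" := (Eq s t) : fo_scope.
Notation "s < t" := (Lt s t) : fo_scope.
Notation "s <= t" := (Le s t) : fo_scope.
Notation "~ p" := (Not p) : fo_scope.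
Notation "p /\ q" := (And p q) : fo_scope.
Notation "p \/ q" := (Or p q) : fo_scope.
Notation "p ~~> q" := (Imp p q)
  (at level 90, right associativity) : fo_scope.
Notation "p <-> q" := (Iff p q) : fo_scope.

Local Open Scope fo_scope.

(* Parallel capture-avoiding substitution. *)
Fixpoint tsubst (sigma : nat -> term) (t : term) : term :=
  match t with
  | Var n => sigma n
  | Zero => Zero
  | One => One
  | Add t1 t2 => Add (tsubst sigma t1) (tsubst sigma t2)
  end.

Definition shift (n : nat) : term := Var n.+1.

Definition up (sigma : nat -> term) (n : nat) : term :=
  if n is m.+1 then tsubst shift (sigma m) else Var 0%N.

Fixpoint fsubst (sigma : nat -> term) (p : form) : form :=
  match p with
  | Eq s t => Eq (tsubst sigma s) (tsubst sigma t)
  | Lt s t => Lt (tsubst sigma s) (tsubst sigma t)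
  | InZ t => InZ (tsubst sigma t)
  | InL t => InL (tsubst sigma t)
  | Bot => Bot
  | Imp p1 p2 => Imp (fsubst sigma p1) (fsubst sigma p2)
  | All p1 => All (fsubst (up sigma) p1)
  end.

(* [inst t p] is the result of replacing by [t] the variable bound by the
   quantifier in [All p]. *)
Definition inst (t : term) : form -> form :=
  fsubst (fun n => if n is m.+1 then Var m else t).

(* Natural deduction for classical first-order logic with equality. *)
Inductive nd : seq form -> form -> Prop :=
  | nd_hyp G p : p \in G -> nd G p
  | nd_impI G p q : nd (p :: G) q -> nd G (p ~~> q)
  | nd_impE G p q : nd G (p ~~> q) -> nd G p -> nd G q
  | nd_raa G p : nd ((~ p) :: G) Bot -> nd G p
  | nd_allI G p : nd [seq fsubst shift h | h <- G] p -> nd G (All p)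
  | nd_allE G p t : nd G (All p) -> nd G (inst t p)
  | nd_refl G t : nd G (t == t)
  | nd_subst G p s t : nd G (s == t) -> nd G (inst s p) -> nd G (inst t p).

Definition provable (T : form -> Prop) (p : form) : Prop :=
  exists2 G : seq form, (forall h, h \in G -> T h) & nd G p.

Local Notation x0 := (Var 0%N).
Local Notation x1 := (Var 1%N).
Local Notation x2 := (Var 2).

Definition tmuln (n : nat) (t : term) : term := iter n (Add t) Zero.

Inductive three_groups : form -> Prop :=
  (* Q is a divisible totally ordered abelian group. *)
  | Q_addA : three_groups
      (All (All (All ((x2 + x1) + x0 == x2 + (x1 + x0)))))
  | Q_addC : three_groups (All (All (x1 + x0 == x0 + x1)))
  | Q_add0 : three_groups (All (x0 + 0 == x0))
  | Q_opp : three_groups (All (Ex (x1 + x0 == 0)))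
  | Q_lt_irr : three_groups (All (~ (x0 < x0)))
  | Q_lt_trans : three_groups
      (All (All (All (x2 < x1 ~~> x1 < x0 ~~> x2 < x0))))
  | Q_lt_total : three_groups (All (All (x1 < x0 \/ x1 == x0 \/ x0 < x1)))
  | Q_lt_add : three_groups
      (All (All (All (x2 < x1 ~~> x2 + x0 < x1 + x0))))
  | Q_div n : (0 < n)%N -> three_groups (All (Ex (tmuln n x0 == x1)))
  (* Z is an integer part of Q with least positive element 1. *)
  | Z_0 : three_groups (InZ 0)
  | Z_add : three_groups (All (All (InZ x1 ~~> InZ x0 ~~> InZ (x1 + x0))))
  | Z_opp : three_groups (All (All (InZ x1 ~~> x1 + x0 == 0 ~~> InZ x0)))
  | Z_1 : three_groups (InZ 1)
  | Z_lt01 : three_groups (0 < 1)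
  | Z_least : three_groups (All (InZ x0 ~~> 0 < x0 ~~> 1 <= x0))
  (* |x - n| <= 1, written without subtraction. *)
  | Z_part : three_groups
      (All (Ex (InZ x0 /\ x1 <= x0 + 1 /\ x0 <= x1 + 1)))
  (* L is a convex subgroup of Q containing 1. *)
  | L_0 : three_groups (InL 0)
  | L_add : three_groups (All (All (InL x1 ~~> InL x0 ~~> InL (x1 + x0))))
  | L_opp : three_groups (All (All (InL x1 ~~> x1 + x0 == 0 ~~> InL x0)))
  | L_convex : three_groups
      (All (All (All (InL x2 ~~> InL x0 ~~> x2 <= x1 ~~> x1 <= x0 ~~> InL x1))))
  | L_1 : three_groups (InL 1).

(* Subtraction and integer part are not in the signature but are definable in
   the theory.  [xterm] is the language of terms enriched with them, and
   [value_is] unfolds the definitions. *)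
Inductive xterm : Type :=
  | XVar of nat
  | XZero
  | XOne
  | XAdd of xterm & xterm
  | XOpp of xterm
  | XFloor of xterm.

(* "t is the value of e", where the variable i of [e] is read as [Var (k + i)];
   k counts the quantifiers under which [e] has been moved, whereas [t] is a
   term of the current context. *)
Fixpoint value_is (k : nat) (e : xterm) (t : term) : form :=
  match e with
  | XVar i => (t == Var (k + i)%N)
  | XZero => (t == 0)
  | XOne => (t == 1)
  | XAdd a b => Ex (Ex (value_is k.+2 a x1 /\ value_is k.+2 b x0
                        /\ tsubst shift (tsubst shift t) == x1 + x0))
  | XOpp a => Ex (value_is k.+1 a x0 /\ tsubst shift t + x0 == 0)
  | XFloor a => Ex (value_is k.+1 a x0 /\
                    (let u := tsubst shift t in
                     InZ u /\ u <= x0 /\ x0 < u + 1))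
  end.

Definition XSub (a b : xterm) : xterm := XAdd a (XOpp b).
Definition XFrac (a : xterm) : xterm := XSub a (XFloor a).

Definition XMulz (n : int) (e : xterm) : xterm :=
  match n with
  | Posz n => iter n (XAdd e) XZero
  | Negz n => XOpp (iter n.+1 (XAdd e) XZero)
  end.

Definition XInt (n : int) : xterm := XMulz n XOne.

(* The sum of the n_i f(x_i), where [s] lists the pairs (n_i, i). *)
Definition lincomb (f : xterm -> xterm) (s : seq (int * nat)) : xterm :=
  foldr (fun ni e => XAdd (XMulz ni.1 (f (XVar ni.2))) e) XZero s.

Definition xge (a b : xterm) : form :=
  Ex (Ex (value_is 2 a x1 /\ value_is 2 b x0 /\ x0 <= x1)).

Definition xinL (a : xterm) : form := Ex (value_is 1 a x0 /\ InL x0).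

(* a - b lies in mZ *)
Definition xeqmod (m : nat) (a b : xterm) : form :=
  Ex (Ex (value_is 2 (XSub a b) x1 /\ InZ x0 /\ x1 == tmuln m x0)).

(* As negation, conjunction, etc. are abbreviations, closure under [Bot] and
   [Imp] yields all Boolean combinations. *)
Inductive special : form -> Prop :=
  | special_frac s n : special (xge (lincomb XFrac s) (XInt n))
  | special_floor s n : special (xge (lincomb XFloor s) (XInt n))
  | special_mod i k m : (k < m)%N ->
      special (xeqmod m (XFloor (XVar i)) (XInt (Posz k)))
  | special_L s : special (xinL (lincomb id s))
  | special_QL : special (All (InL x0))
  | special_Bot : special Bot
  | special_Imp p q : special p -> special q -> special (Imp p q).

(* Main.v *)
From HB Require Import structures.
From mathcomp Require Import all_boot order ssralg ssrnum ssrint intdiv boolp.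
From mathcomp Require Import zify.
Require Import Defs.

(* By completeness it is enough to find one special formula that is equivalent to
   the given one in all models.  In a model, write x = z + f with z = floor(x) and
   0 <= f < 1.  As sums of fractional parts are bounded and lie in L, every atomic
   formula is a Boolean combination of conditions on the z's (linear inequalities,
   congruences, membership in L) and of linear inequalities on the f's, so that the
   two components of a quantified variable can be eliminated separately.
   - For f, the order is dense and it suffices to test the midpoints of any two of
     the critical points occurring in the formula.
   - For z, either z lies in e + L for some critical point e, and then z may be
     moved within its coset modulo L and its congruence class to within a bounded
     distance of a critical point; or z lies in none of these cosets, all conditions
     z - e in L fail, and z may be replaced by a point infinitely close to -oo or to
     the upper end of some e + L, which exists iff L is not the whole group, because
     the quotient by L is divisible, hence densely ordered. *)

Set Implicit Arguments.
Unset Strict Implicit.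
Unset Printing Implicit Defensive.

(** * Completeness of natural deduction *)

Lemma tsubst_comp sigma tau t :
  tsubst sigma (tsubst tau t) = tsubst (tsubst sigma \o tau) t.
Proof. by elim: t => //= s -> t ->. Qed.

Lemma tsubst_id t : tsubst Var t = t.
Proof. by elim: t => //= s -> t ->. Qed.

Lemma up_comp sigma tau :
  tsubst (up sigma) \o up tau = up (tsubst sigma \o tau).
Proof. by apply: funext => -[|n] //=; rewrite !tsubst_comp. Qed.

Lemma up_id : up Var = Var.
Proof. by apply: funext => -[|n]. Qed.

Lemma fsubst_comp sigma tau p :
  fsubst sigma (fsubst tau p) = fsubst (tsubst sigma \o tau) p.
Proof.
elim: p sigma tau => //=.
- by move=> s t sigma tau; rewrite !tsubst_comp.
- by move=> s t sigma tau; rewrite !tsubst_comp.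
- by move=> t sigma tau; rewrite !tsubst_comp.
- by move=> t sigma tau; rewrite !tsubst_comp.
- by move=> p IHp q IHq sigma tau; rewrite IHp IHq.
- by move=> p IHp sigma tau; rewrite IHp up_comp.
Qed.

Lemma fsubst_id p : fsubst Var p = p.
Proof.
elim: p => //=.
- by move=> s t; rewrite !tsubst_id.
- by move=> s t; rewrite !tsubst_id.
- by move=> t; rewrite tsubst_id.
- by move=> t; rewrite tsubst_id.
- by move=> p -> q ->.
- by move=> p IHp; rewrite up_id IHp.
Qed.

Lemma fsubst_up_shift sigma p :
  fsubst (up sigma) (fsubst shift p) = fsubst shift (fsubst sigma p).
Proof. by rewrite !fsubst_comp. Qed.

Definition scons T (x : T) (e : nat -> T) (n : nat) : T :=
  if n is m.+1 then e m else x.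

Lemma fsubst_inst sigma t p :
  fsubst sigma (inst t p) = inst (tsubst sigma t) (fsubst (up sigma) p).
Proof.
rewrite /inst !fsubst_comp; congr fsubst; apply: funext => -[|n] //=.
by rewrite tsubst_comp; apply: esym; apply: tsubst_id.
Qed.

Lemma inst_up t sigma p : inst t (fsubst (up sigma) p) = fsubst (scons t sigma) p.
Proof.
rewrite /inst fsubst_comp; congr fsubst; apply: funext => -[|n] //=.
by rewrite tsubst_comp; apply: tsubst_id.
Qed.

Lemma tsubst_shiftK t s :
  tsubst (fun n => if n is m.+1 then Var m else t) (tsubst shift s) = s.
Proof. by rewrite tsubst_comp; apply: tsubst_id. Qed.

(** The images of the hypotheses may lie anywhere in [G'], so the induction covers renaming and
    weakening at once; the quantifier and equality rules rest on the commutation of substitution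
    with [shift] and [inst]. *)
Lemma nd_fsubst G p sigma G' :
  nd G p -> (forall h, h \in G -> fsubst sigma h \in G') ->
  nd G' (fsubst sigma p).
Proof.
move=> d; elim: d sigma G' => {G p} /=.
- by move=> G p pG sigma G' sub; apply: nd_hyp; apply: sub.
- move=> G p q _ IH sigma G' sub; apply: nd_impI; apply: IH => h.
  by rewrite in_cons => /predU1P[->|/sub e]; [exact: mem_head|rewrite in_cons e orbT].
- by move=> G p q _ IH1 _ IH2 sigma G' sub; apply: nd_impE (IH1 _ _ sub) (IH2 _ _ sub).
- move=> G p _ IH sigma G' sub; apply: nd_raa; apply: IH => h.
  by rewrite in_cons => /predU1P[->|/sub e]; [exact: mem_head|rewrite in_cons e orbT].
- move=> G p _ IH sigma G' sub; apply: nd_allI; apply: IH => h /mapP[h0 h0G ->].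
  by rewrite fsubst_up_shift; apply: map_f; apply: sub.
- by move=> G p t _ IH sigma G' sub; rewrite fsubst_inst; apply: nd_allE; apply: IH.
- by move=> G t sigma G' sub; apply: nd_refl.
- move=> G p s t _ IH1 _ IH2 sigma G' sub; rewrite fsubst_inst.
  by apply: nd_subst (IH1 _ _ sub) _; rewrite -fsubst_inst; apply: IH2.
Qed.

Lemma nd_weak G p G' : nd G p -> {subset G <= G'} -> nd G' p.
Proof.
by move=> d sub; rewrite -[p]fsubst_id; apply: nd_fsubst d _ => h /sub; rewrite fsubst_id.
Qed.

(** Semantic rendering of the condition that all free variables are below [n]; closed formulas are
    the case [n = 0]. *)
Definition fbound (n : nat) (p : form) : Prop :=
  forall sigma tau, (forall i, i < n -> sigma i = tau i) ->
  fsubst sigma p = fsubst tau p.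

Fixpoint term_bound (t : term) : nat :=
  match t with
  | Var i => i.+1
  | Zero | One => 0
  | Add s t => maxn (term_bound s) (term_bound t)
  end.

(** The bound is not lowered under [All]: an overestimate suffices for choosing fresh variables, and
    it then bounds the body of the quantifier as well. *)
Fixpoint form_bound (p : form) : nat :=
  match p with
  | Eq s t | Lt s t => maxn (term_bound s) (term_bound t)
  | InZ t | InL t => term_bound t
  | Bot => 0
  | Imp p q => maxn (form_bound p) (form_bound q)
  | All p => form_bound p
  end.

Lemma term_boundP t n sigma tau : term_bound t <= n ->
  (forall i, i < n -> sigma i = tau i) -> tsubst sigma t = tsubst tau t.
Proof.
move=> tn e; elim: t tn => //= s IHs t IHt; by rewrite geq_max => /andP[/IHs-> /IHt->].
Qed.

Lemma form_boundP p n : form_bound p <= n -> fbound n p.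
Proof.
elim: p n => //=.
- move=> s t n; rewrite geq_max => /andP[sn tn] sigma tau e /=.
  by rewrite (term_boundP sn e) (term_boundP tn e).
- move=> s t n; rewrite geq_max => /andP[sn tn] sigma tau e /=.
  by rewrite (term_boundP sn e) (term_boundP tn e).
- by move=> t n tn sigma tau e /=; rewrite (term_boundP tn e).
- by move=> t n tn sigma tau e /=; rewrite (term_boundP tn e).
- move=> p IHp q IHq n; rewrite geq_max => /andP[pn qn] sigma tau e /=.
  by rewrite (IHp _ pn _ _ e) (IHq _ qn _ _ e).
- move=> p IHp n pn sigma tau e /=; congr All; apply: (IHp _ pn) => -[|i] //= /ltnW /e.
  by move=> ->.
Qed.

(** * Countability of terms and formulas *)

Fixpoint tree_of_term (t : term) : GenTree.tree nat :=
  match t with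
  | Var i => GenTree.Leaf i
  | Zero => GenTree.Node 0 [::]
  | One => GenTree.Node 1 [::]
  | Add s t => GenTree.Node 2 [:: tree_of_term s; tree_of_term t]
  end.

Fixpoint term_of_tree (u : GenTree.tree nat) : term :=
  match u with
  | GenTree.Leaf i => Var i
  | GenTree.Node 0 _ => Zero
  | GenTree.Node _ [:: u; v] => Add (term_of_tree u) (term_of_tree v)
  | GenTree.Node _ _ => One
  end.

Lemma tree_of_termK : cancel tree_of_term term_of_tree.
Proof. by elim=> //= s -> t ->. Qed.

HB.instance Definition _ := Countable.copy term (can_type tree_of_termK).

Fixpoint tree_of_form (p : form) : GenTree.tree nat :=
  match p with
  | Eq s t => GenTree.Node 0 [:: tree_of_term s; tree_of_term t]
  | Lt s t => GenTree.Node 1 [:: tree_of_term s; tree_of_term t]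
  | InZ t => GenTree.Node 2 [:: tree_of_term t]
  | InL t => GenTree.Node 3 [:: tree_of_term t]
  | Bot => GenTree.Node 4 [::]
  | Imp p q => GenTree.Node 5 [:: tree_of_form p; tree_of_form q]
  | All p => GenTree.Node 6 [:: tree_of_form p]
  end.

Fixpoint form_of_tree (u : GenTree.tree nat) : form :=
  match u with
  | GenTree.Node 0 [:: u; v] => Eq (term_of_tree u) (term_of_tree v)
  | GenTree.Node 1 [:: u; v] => Lt (term_of_tree u) (term_of_tree v)
  | GenTree.Node 2 [:: u] => InZ (term_of_tree u)
  | GenTree.Node 3 [:: u] => InL (term_of_tree u)
  | GenTree.Node 5 [:: u; v] => Imp (form_of_tree u) (form_of_tree v)
  | GenTree.Node 6 [:: u] => All (form_of_tree u)
  | _ => Bot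
  end.

Lemma tree_of_formK : cancel tree_of_form form_of_tree.
Proof. by elim=> //= [s t|s t|t|t|p -> q ->|p ->]; rewrite ?tree_of_termK. Qed.

HB.instance Definition _ := Countable.copy form (can_type tree_of_formK).

(** * Structures and satisfaction *)

Record structure := Structure {
  dom : Type;
  szero : dom;
  sone : dom;
  sadd : dom -> dom -> dom;
  slt : dom -> dom -> Prop;
  sZ : dom -> Prop;
  sL : dom -> Prop }.

Section Semantics.

Variable M : structure.

Fixpoint tval (e : nat -> dom M) (t : term) : dom M :=
  match t with
  | Var i => e i
  | Zero => szero M
  | One => sone M
  | Add s t => sadd (tval e s) (tval e t)
  end.

Fixpoint sat (e : nat -> dom M) (p : form) : Prop :=
  match p with
  | Eq s t => tval e s = tval e t
  | Lt s t => slt (tval e s) (tval e t)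
  | InZ t => sZ (tval e t)
  | InL t => sL (tval e t)
  | Bot => False
  | Imp p q => sat e p -> sat e q
  | All p => forall x, sat (scons x e) p
  end.

End Semantics.

(** * The Henkin model of a consistent list of formulas *)

Section Henkin.

Variable T : form -> Prop.
Hypothesis T_closed : forall h, T h -> fbound 0 h.

Definition entails (G : seq form) (p : form) : Prop :=
  exists2 H : seq form, (forall h, h \in H -> T h) & nd (G ++ H) p.

Lemma entails_nd G p : nd G p -> entails G p.
Proof. by move=> d; exists [::]; rewrite ?cats0. Qed.

Lemma entails_weak G G' p : entails G p -> {subset G <= G'} -> entails G' p.
Proof.
move=> [H HT d] sub; exists H => //; apply: nd_weak d _ => h.
by rewrite !mem_cat => /orP[/sub->|->]; rewrite ?orbT.
Qed.

Lemma entails_cut G p q : entails G p -> nd (p :: G) q -> entails G q.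
Proof.
move=> [H HT d] dq; exists H => //.
have d' : nd (G ++ H) (Imp p q).
  apply: nd_impI; apply: nd_weak dq _ => h.
  by rewrite !inE mem_cat => /orP[->//|->]; rewrite orbT.
exact: nd_impE d' d.
Qed.

Lemma entails_cut2 G p q r :
  entails G p -> entails G q -> nd [:: p; q] r -> entails G r.
Proof.
move=> [H HT d] [K KT dK] dr; exists (H ++ K).
  by move=> h; rewrite mem_cat => /orP[/HT|/KT].
have d' : nd (G ++ (H ++ K)) (Imp q (Imp p r)).
  do 2!apply: nd_impI; apply: nd_weak dr _ => h.
  by rewrite !inE => /orP[->|->]; rewrite ?orbT.
have sub1 : {subset G ++ H <= G ++ (H ++ K)}.
  by move=> h; rewrite !mem_cat => /orP[->//|->]; rewrite ?orbT.
have sub2 : {subset G ++ K <= G ++ (H ++ K)}.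
  by move=> h; rewrite !mem_cat => /orP[->//|->]; rewrite ?orbT.
exact: nd_impE (nd_impE d' (nd_weak dK sub2)) (nd_weak d sub1).
Qed.

Lemma entails_impI G p q : entails (p :: G) q -> entails G (Imp p q).
Proof. by move=> [H HT d]; exists H => //; apply: nd_impI. Qed.

Lemma entails_raa G p : entails (Not p :: G) Bot -> entails G p.
Proof. by move=> [H HT d]; exists H => //; apply: nd_raa. Qed.

Lemma nd_hyp0 G p : nd (p :: G) p.
Proof. by apply: nd_hyp; rewrite mem_head. Qed.

Lemma nd_hyp1 G p q : nd (p :: q :: G) q.
Proof. by apply: nd_hyp; rewrite !inE eqxx orbT. Qed.

(** Generalisation on the variable [k], which occurs neither in [G] and [p] nor in the closed
    axioms: a renaming puts the whole derivation under the binder. *)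
Lemma entails_gen G k p : (forall h, h \in G -> fbound k h) -> fbound k p ->
  entails G (inst (Var k) p) -> entails G (All p).
Proof.
move=> kG kp [H HT d]; exists H => //; apply: nd_allI.
(* Shifts the variables below [k] and turns [k] into the bound variable. *)
pose sigma i := if i < k then Var i.+1 else Var 0.
suff <- : fsubst sigma (inst (Var k) p) = p.
  apply: nd_fsubst d _ => h hGH; apply/mapP; exists h => //.
  move: hGH; rewrite mem_cat => /orP[/kG kh|/HT/T_closed kh]; apply: kh => i //.
  by rewrite /sigma => ->.
rewrite /inst fsubst_comp -[RHS]fsubst_id; apply: kp => -[|i] ik /=.
  by rewrite /sigma ltnn.
by rewrite /sigma ltnW.
Qed.

Definition consistent (G : seq form) : Prop := ~ entails G Bot.

Definition fresh (G : seq form) : nat := foldr (fun h => maxn (form_bound h)) 0 G.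

Lemma freshP G h : h \in G -> fbound (fresh G) h.
Proof.
move=> hG; apply: form_boundP; elim: G hG => //= g G IH.
by rewrite inE leq_max => /orP[/eqP->|/IH->]; rewrite ?leqnn ?orbT.
Qed.

(* Since the axioms are closed, free variables can play the role of the Henkin
   constants. *)
Definition witness (G : seq form) : seq form :=
  if G is Imp (All p) Bot :: _ then [:: Not (inst (Var (fresh G)) p)] else [::].

(** If the witness were contradictory, [G] would prove the instance of [p] at a fresh variable,
    hence [All p], against its own head [Not (All p)]. *)
Lemma consistent_witness G : consistent G -> consistent (witness G ++ G).
Proof.
case: G => //= -[] // -[] // p [] // G conG; apply: contra_not conG => /= ent.
have fb : fbound (fresh [:: Not (All p) & G]) p.
  by apply: form_boundP => /=; rewrite maxn0 leq_maxl.
have /entails_cut : entails (Not (All p) :: G) (All p).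
  by apply: (entails_gen (@freshP _) fb); apply: entails_raa.
apply; apply: nd_impE (nd_hyp0 _ _); exact: nd_hyp1.
Qed.

Variable G0 : seq form.
Hypothesis conG0 : consistent G0.

Definition extend (G : seq form) (A : option form) : seq form :=
  if A is Some p then
    if `[< consistent (p :: G) >] then witness (p :: G) ++ p :: G else G
  else G.

(** Lindenbaum's construction along the enumeration of formulas. *)
Fixpoint stage (n : nat) : seq form :=
  if n is m.+1 then extend (stage m) (unpickle m) else G0.

Lemma consistent_stage n : consistent (stage n).
Proof.
elim: n => //= n IHn; rewrite /extend; case: unpickle => // p.
by case: ifP => // /asboolP /consistent_witness.
Qed.

Lemma stageS n : {subset stage n <= stage n.+1}.
Proof.
move=> h hn /=; rewrite /extend; case: unpickle => // p; case: ifP => // _.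
by rewrite mem_cat inE hn !orbT.
Qed.

Lemma stage_le m n : m <= n -> {subset stage m <= stage n}.
Proof.
elim: n => [|n IHn]; first by rewrite leqn0 => /eqP->.
rewrite leq_eqVlt => /orP[/eqP->//|/IHn sub] h /sub; exact: stageS.
Qed.

Definition limit (p : form) : Prop := exists n, p \in stage n.

(** When its code comes up, [p] is either added or refuted; a refutation would contradict the
    derivation of [p] at a common later stage. *)
Lemma limit_entails n p : entails (stage n) p -> limit p.
Proof.
move=> ent; exists (pickle p).+1 => /=; rewrite pickleK /=.
case: ifP => [_|/asboolP/contrapT incon]; first by rewrite mem_cat mem_head orbT.
case: (@consistent_stage (maxn n (pickle p))).
have ent1 := entails_weak ent (stage_le (leq_maxl n (pickle p))).
have /entails_weak/(_ (stage_le (leq_maxr n _))) ent2 := entails_impI incon.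
by apply: (entails_cut2 ent1 ent2); apply: nd_impE (nd_hyp0 _ _); apply: nd_hyp1.
Qed.

Lemma limit_nd p : nd [::] p -> limit p.
Proof. by move=> d; apply: (@limit_entails 0); apply: entails_nd; apply: nd_weak d _. Qed.

Lemma limit_nd1 p q : limit p -> nd [:: p] q -> limit q.
Proof.
move=> [n pn] d; apply: (@limit_entails n); apply: entails_nd; apply: nd_weak d _.
by move=> h; rewrite inE => /eqP->.
Qed.

Lemma limit_nd2 p q r : limit p -> limit q -> nd [:: p; q] r -> limit r.
Proof.
move=> [m pm] [n qn] d; apply: (@limit_entails (maxn m n)); apply: entails_nd.
apply: nd_weak d _ => h; rewrite !inE => /orP[]/eqP->.
  exact: stage_le (leq_maxl _ _) _ pm.
exact: stage_le (leq_maxr _ _) _ qn.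
Qed.

Lemma limit_theory h : T h -> limit h.
Proof.
move=> Th; apply: (@limit_entails 0); exists [:: h]; last first.
  by apply: nd_hyp; rewrite mem_cat mem_head orbT.
by move=> h'; rewrite inE => /eqP->.
Qed.

Lemma limit_Bot : ~ limit Bot.
Proof.
move=> [n Bn]; apply: (@consistent_stage n); apply: entails_nd; exact: nd_hyp.
Qed.

Lemma limit_Not p : limit (Not p) <-> ~ limit p.
Proof.
split=> [Np P|NP].
  by apply: limit_Bot; apply: (limit_nd2 Np P); apply: nd_impE (nd_hyp0 _ _) (nd_hyp1 _ _ _).
apply: (@limit_entails (pickle p)); apply: entails_impI.
apply: contrapT => con; apply: NP; exists (pickle p).+1 => /=; rewrite pickleK /=.
by rewrite (asboolT con) mem_cat mem_head orbT.
Qed.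

Lemma limit_Imp p q : limit (Imp p q) <-> (limit p -> limit q).
Proof.
split=> [pq P|pq].
  by apply: (limit_nd2 pq P); apply: nd_impE (nd_hyp0 _ _) (nd_hyp1 _ _ _).
have [/pq Q|/limit_Not NP] := EM (limit p).
  by apply: (limit_nd1 Q); apply: nd_impI; apply: nd_hyp1.
apply: (limit_nd1 NP); apply: nd_impI; apply: nd_raa.
by apply: nd_impE (nd_hyp1 _ _ _); apply: nd_hyp; rewrite !inE eqxx !orbT.
Qed.

Lemma limit_All p : limit (All p) <-> forall t, limit (inst t p).
Proof.
split=> [P t|P].
  by apply: (limit_nd1 P); apply: nd_allE; apply: nd_hyp0.
apply: contrapT => /limit_Not NP.
case: (NP) => n Nn.
(* Since [Not (All p)] belongs to the limit, it is consistent with the stage at which its code comes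
   up, so its witness was added there. *)
have [m um] : exists m, unpickle m = Some (Not (All p)).
  by exists (pickle (Not (All p))); rewrite pickleK.
have con : consistent (Not (All p) :: stage m).
  move=> ent; apply: (@consistent_stage (maxn m n)).
  apply: (entails_weak ent) => h; rewrite in_cons => /predU1P[->|].
    exact: stage_le (leq_maxr _ _) _ Nn.
  exact: stage_le (leq_maxl _ _) h.
have : limit (Not (inst (Var (fresh (Not (All p) :: stage m))) p)).
  by exists m.+1; rewrite /= um /= (asboolT con) mem_head.
by move/limit_Not; apply.
Qed.

Lemma limit_subst p s t : limit (Eq s t) -> limit (inst s p) -> limit (inst t p).
Proof.
by move=> st ps; apply: (limit_nd2 st ps); apply: nd_subst (nd_hyp0 _ _) (nd_hyp1 _ _ _).
Qed.

Lemma limit_refl t : limit (Eq t t).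
Proof. by apply: limit_nd; apply: nd_refl. Qed.

(** Replacement in a context [C] whose hole is the variable 0 of [p]; in the uses below the other
    terms are shifted in [p], and [inst] shifts them back. *)
Lemma limit_rewrite (C : term -> form) p s t :
  (forall u, C u = inst u p) -> limit (Eq s t) -> limit (C s) -> limit (C t).
Proof. by move=> Cp st; rewrite !Cp; apply: limit_subst. Qed.

Lemma limit_sym s t : limit (Eq s t) -> limit (Eq t s).
Proof.
move=> st; apply: (limit_rewrite (C := fun u => Eq u s)
  (p := Eq (Var 0) (tsubst shift s)) _ st (limit_refl s)) => u.
by rewrite /inst /= tsubst_shiftK.
Qed.

Lemma limit_trans s t u : limit (Eq s t) -> limit (Eq t u) -> limit (Eq s u).
Proof.
move=> st tu; apply: (limit_rewrite (C := fun v => Eq s v)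
  (p := Eq (tsubst shift s) (Var 0)) _ tu st) => v.
by rewrite /inst /= tsubst_shiftK.
Qed.

Lemma limit_Add s s' t t' :
  limit (Eq s s') -> limit (Eq t t') -> limit (Eq (Add s t) (Add s' t')).
Proof.
move=> ss tt.
have := limit_refl (Add s t).
move/(limit_rewrite (C := fun v => Eq (Add s t) (Add v t))
  (p := Eq (tsubst shift (Add s t)) (Add (Var 0) (tsubst shift t))) _ ss).
move=> H; have {}H := H _.
have /(limit_rewrite (C := fun v => Eq (Add s t) (Add s' v))
  (p := Eq (tsubst shift (Add s t)) (Add (tsubst shift s') (Var 0))) _ tt) :
  limit (Eq (Add s t) (Add s' t)) by apply: H => u; rewrite /inst /= !tsubst_shiftK.
by apply=> u; rewrite /inst /= !tsubst_shiftK.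
Qed.

Lemma limit_Lt s s' t t' :
  limit (Eq s s') -> limit (Eq t t') -> limit (Lt s t) -> limit (Lt s' t').
Proof.
move=> ss tt st.
have {}st : limit (Lt s' t).
  apply: (limit_rewrite (C := fun v => Lt v t)
    (p := Lt (Var 0) (tsubst shift t)) _ ss st) => u.
  by rewrite /inst /= tsubst_shiftK.
apply: (limit_rewrite (C := fun v => Lt s' v)
  (p := Lt (tsubst shift s') (Var 0)) _ tt st) => u.
by rewrite /inst /= tsubst_shiftK.
Qed.

Lemma limit_InZ s t : limit (Eq s t) -> limit (InZ s) -> limit (InZ t).
Proof. exact: (limit_rewrite (C := InZ) (p := InZ (Var 0))). Qed.

Lemma limit_InL s t : limit (Eq s t) -> limit (InL s) -> limit (InL t).
Proof. exact: (limit_rewrite (C := InL) (p := InL (Var 0))). Qed.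

Definition eqt (s t : term) : bool := `[< limit (Eq s t) >].

Lemma eqt_ex s : exists t, eqt s t.
Proof. by exists s; apply/asboolP; apply: limit_refl. Qed.

(** A chosen representative of the class of [s] under provable equality; canonical terms take the
    place of a quotient. *)
Definition canon (s : term) : term := xchoose (eqt_ex s).

Lemma canonP s : limit (Eq s (canon s)).
Proof. by apply/asboolP; apply: (xchooseP (eqt_ex s)). Qed.

Lemma canon_eq s t : limit (Eq s t) -> canon s = canon t.
Proof.
move=> st; apply: eq_xchoose => u; apply/asboolP/asboolP => h.
  exact: limit_trans (limit_sym st) h.
exact: limit_trans st h.
Qed.

Lemma canonK s : canon (canon s) == canon s.
Proof. by apply/eqP; apply: canon_eq; apply: limit_sym; apply: canonP. Qed.

Definition cterm := {t : term | canon t == t}.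

Definition cls (t : term) : cterm := exist (fun t => canon t == t) _ (canonK t).

Lemma cls_val (c : cterm) : cls (val c) = c.
Proof. by apply: val_inj => /=; apply/eqP; apply: (valP c). Qed.

Lemma cls_eq s t : cls s = cls t <-> limit (Eq s t).
Proof.
split=> [[e]|/canon_eq e]; last exact: val_inj.
apply: limit_trans (canonP s) _; rewrite e; apply: limit_sym; exact: canonP.
Qed.

Definition henkin : structure := {|
  dom := cterm;
  szero := cls Zero;
  sone := cls One;
  sadd c d := cls (Add (val c) (val d));
  slt c d := limit (Lt (val c) (val d));
  sZ c := limit (InZ (val c));
  sL c := limit (InL (val c)) |}.

Lemma tval_henkin sigma t :
  tval (M := henkin) (cls \o sigma) t = cls (tsubst sigma t).
Proof.
elim: t => //= s -> t ->; apply/cls_eq/limit_Add; apply: limit_sym; exact: canonP.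
Qed.

(** The truth lemma. It is stated for all [sigma] because the quantifier case extends the
    environment by the class of an arbitrary term. *)
Lemma sat_henkin p sigma :
  sat (M := henkin) (cls \o sigma) p <-> limit (fsubst sigma p).
Proof.
elim: p sigma => [s t|s t|t|t||p IHp q IHq|p IHp] sigma; rewrite /= ?tval_henkin.
- exact: cls_eq.
- by split; apply: limit_Lt; [apply: limit_sym|apply: limit_sym| |]; apply: canonP.
- by split; apply: limit_InZ; [apply: limit_sym|]; apply: canonP.
- by split; apply: limit_InL; [apply: limit_sym|]; apply: canonP.
- by split=> // /limit_Bot.
- by rewrite limit_Imp IHp IHq.
have consE t : scons (cls t) (cls \o sigma) = cls \o scons t sigma.
  by apply: funext => -[|n].
rewrite limit_All; split=> h.
  by move=> t; rewrite inst_up -IHp -consE; apply: h.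
by move=> c; rewrite -(cls_val c) consE IHp -inst_up; apply: h.
Qed.

End Henkin.

Theorem completeness (T : form -> Prop) p :
  (forall h, T h -> fbound 0 h) ->
  (forall (M : structure) (e : nat -> dom M),
    (forall h e', T h -> sat (M := M) e' h) -> sat e p) ->
  provable T p.
Proof.
move=> Tcl val; apply: contrapT => np.
have con : consistent T [:: Not p].
  apply: contra_not np => /entails_raa [H HT d]; exists H => //.
have sE h : sat (M := henkin Tcl con) (cls Tcl con \o Var) h <-> limit T [:: Not p] h.
  by rewrite sat_henkin // fsubst_id.
have : limit T [:: Not p] (Not p) by exists 0; rewrite mem_head.
move/(limit_Not Tcl con); apply; apply/sE/val => h e' Th.
(* Every environment of the model comes from a substitution, and a closed axiom is unchanged by
   it. *)
have -> : e' = cls Tcl con \o (fun i => sval (e' i)).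
  by apply: funext => i /=; rewrite cls_val.
rewrite sat_henkin //.
have -> : fsubst (fun i => sval (e' i)) h = h.
  by rewrite -[RHS]fsubst_id; apply: (Tcl h Th).
exact: limit_theory.
Qed.

Lemma three_groups_closed h : three_groups h -> fbound 0 h.
Proof.
have tm sigma n : tsubst sigma (tmuln n (Var 0)) = tmuln n (sigma 0).
  by elim: n => //= n ->.
by case=> *; move=> sigma tau _ //=; rewrite !tm.
Qed.

(** * Models as ordered groups *)

Import Order.TTheory GRing.Theory Num.Theory.
Local Open Scope ring_scope.

(** Models of the theory with the group packaged as a [zmodType]. A weak inequality between [x] and
    [y] is written [~ tlt y x], which is equivalent by totality. *)
Record tgroup := TGroup {
  car :> zmodType;
  one : car;
  tlt : car -> car -> Prop;
  isZ : car -> Prop;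
  isL : car -> Prop;
  tlt_irr : forall x, ~ tlt x x;
  tlt_trans : forall x y z, tlt x y -> tlt y z -> tlt x z;
  tlt_total : forall x y, tlt x y \/ x = y \/ tlt y x;
  tlt_add : forall x y z, tlt x y -> tlt (x + z) (y + z);
  tdiv_ex : forall n (x : car), (0 < n)%N -> exists y, y *+ n = x;
  isZ0 : isZ 0;
  isZD : forall x y, isZ x -> isZ y -> isZ (x + y);
  isZN : forall x, isZ x -> isZ (- x);
  isZ1 : isZ one;
  one_gt0 : tlt 0 one;
  isZ_least : forall x, isZ x -> tlt 0 x -> ~ tlt x one;
  isZ_part : forall x, exists n, [/\ isZ n, ~ tlt (n + one) x & ~ tlt (x + one) n];
  isL0 : isL 0;
  isLD : forall x y, isL x -> isL y -> isL (x + y);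
  isLN : forall x, isL x -> isL (- x);
  isL_convex : forall x y z, isL x -> isL z -> ~ tlt y x -> ~ tlt z y -> isL y;
  isL1 : isL one }.

Definition tgroup_structure (G : tgroup) : structure :=
  @Structure G 0 (one G) +%R (@tlt G) (@isZ G) (@isL G).

Lemma sat_Ex (M : structure) (e : nat -> dom M) p :
  sat e (Ex p) <-> exists x, sat (scons x e) p.
Proof.
split=> [h|[x px] h]; last exact: (h x).
by apply: contrapT => np; apply: h => x px; apply: np; exists x.
Qed.

Lemma sat_And (M : structure) (e : nat -> dom M) p q :
  sat e (And p q) <-> sat e p /\ sat e q.
Proof.
split=> [h|[hp hq] h]; last exact: h.
by split; apply: contrapT => n; apply: h => // hp hq.
Qed.

Lemma sat_Or (M : structure) (e : nat -> dom M) p q :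
  sat e (Or p q) <-> sat e p \/ sat e q.
Proof.
split=> [h|[hp np|hq _]]; [|by case: (np hp)|exact: hq].
by have [hp|np] := EM (sat e p); [left|right; apply: h].
Qed.

Lemma sat_All (M : structure) (e : nat -> dom M) p :
  sat e (All p) -> forall x, sat (scons x e) p.
Proof. exact. Qed.

Lemma tval_tmuln (M : structure) (e : nat -> dom M) n t :
  tval e (tmuln n t) = iter n (sadd (tval e t)) (szero M).
Proof. by elim: n => //= n ->. Qed.

(** The group structure is put on the domain of [M] itself, so that the result is an equality of
    structures and not merely an isomorphism. *)
Lemma model_tgroup (M : structure) :
  (forall h (e : nat -> dom M), three_groups h -> sat e h) ->
  exists G, M = tgroup_structure G.
Proof.
move=> MT; have {}MT h : three_groups h -> sat (fun _ => szero M) h.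
  exact: MT.
case: M MT => D d0 d1 add lt Z L MT.
have addA x y z : add (add x y) z = add x (add y z) by exact: (MT _ Q_addA x y z).
have addC x y : add x y = add y x by exact: (MT _ Q_addC x y).
have addx0 x : add x d0 = x by exact: (MT _ Q_add0 x).
(* The signature has no opposite; the axiom only asserts its existence, and a function is obtained
   by choice. *)
have /choice[opp addN] : forall x, exists y, add x y = d0.
  by move=> x; have [y hy] := (sat_Ex _ _).1 (sat_All (MT _ Q_opp) x); exists y.
pose C : choiceType := HB.pack D (gen_eqMixin D) (gen_choiceMixin D).
have addA' : @associative C add by move=> x y z; rewrite addA.
have add0x : @left_id C C d0 add by move=> x; rewrite addC addx0.
have addNx : @left_inverse C C C d0 opp add by move=> x; rewrite addC addN.
pose V : zmodType := HB.pack C (GRing.isZmodule.Build C addA' addC add0x addNx).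
have lt_irr (x : V) : ~ lt x x by exact: (MT _ Q_lt_irr x).
have lt_trans (x y z : V) : lt x y -> lt y z -> lt x z.
  exact: (MT _ Q_lt_trans x y z).
have lt_total (x y : V) : lt x y \/ x = y \/ lt y x.
  have [h|h] := (sat_Or _ _ _).1 (sat_All (sat_All (MT _ Q_lt_total) x) y).
    by left.
  by right; have [{}h|{}h] := (sat_Or _ _ _).1 h; [left|right].
(* The formula [Le] unfolds to [~ lt x y -> x = y]; this fact and [le_lt] convert between it and
   [~ lt y x]. *)
have lt_le (x y : V) : (~ lt x y -> x = y) -> ~ lt y x.
  move=> xy yx; have [xy'|] := EM (lt x y).
    exact: (lt_irr x (lt_trans _ _ _ xy' yx)).
  by move/xy => e; apply: (lt_irr x); rewrite {1}e.
have le_lt (x y : V) : ~ lt y x -> (~ lt x y -> x = y).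
  by move=> h h'; case: (lt_total x y) => [//|[]].
have oppE (x y : V) : add x y = d0 -> y = - x.
  by move=> e; apply: (@addrI V x); rewrite subrr.
unshelve eexists (@TGroup V d1 lt Z L _ _ _ _ _ _ _ _ _ _ _ _ _ _ _ _ _) => //.
- by move=> x y z; exact: (MT _ Q_lt_add x y z).
- move=> n x n0; have [y] := (sat_Ex _ _).1 (sat_All (MT _ (Q_div n0)) x).
  rewrite /= tval_tmuln /= => <-; exists y; elim: n {n0} => // n IHn.
  by rewrite mulrS IHn.
- exact: (MT _ Z_0).
- by move=> x y; exact: (MT _ Z_add x y).
- by move=> x Zx; apply: (MT _ Z_opp x (- x) Zx); exact: (@subrr V x).
- exact: (MT _ Z_1).
- exact: (MT _ Z_lt01).
- by move=> x Zx x0; apply: lt_le; exact: (MT _ Z_least x Zx x0).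
- move=> x; have [n h] := (sat_Ex _ _).1 (sat_All (MT _ Z_part) x).
  have [Zn {}h] := (sat_And _ _ _).1 h; have [h1 h2] := (sat_And _ _ _).1 h.
  by exists n; split => //; apply: lt_le.
- exact: (MT _ L_0).
- by move=> x y; exact: (MT _ L_add x y).
- by move=> x Lx; apply: (MT _ L_opp x (- x) Lx); exact: (@subrr V x).
- move=> x y z Lx Lz xy yz; apply: (MT _ L_convex x y z Lx Lz); exact: le_lt.
- exact: (MT _ L_1).
Qed.

(** * Linear inequalities over an ordered group *)

Definition tle (G : tgroup) (x y : G) : Prop := ~ tlt y x.

(* Linear consequences over an ordered group are decided by a reflexive
   Fourier-Motzkin procedure, implemented by the tactic [ordered_group]. *)
Inductive aexp :=
  | AVar of nat
  | AZero
  | AAdd of aexp & aexp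
  | AOpp of aexp
  | AMuln of aexp & nat.

Fixpoint aeval (V : zmodType) (env : seq V) (a : aexp) : V :=
  match a with
  | AVar i => nth 0 env i
  | AZero => 0
  | AAdd a b => aeval env a + aeval env b
  | AOpp a => - aeval env a
  | AMuln a n => aeval env a *+ n
  end.

Fixpoint vadd (u v : seq int) : seq int :=
  match u, v with
  | x :: u, y :: v => (x + y) :: vadd u v
  | [::], _ => v
  | _, [::] => u
  end.

Definition vscale (k : int) (u : seq int) : seq int := [seq x * k | x <- u].

Fixpoint anorm (a : aexp) : seq int :=
  match a with
  | AVar i => ncons i 0 [:: 1]
  | AZero => [::]
  | AAdd a b => vadd (anorm a) (anorm b)
  | AOpp a => vscale (-1) (anorm a)
  | AMuln a n => vscale n%:Z (anorm a)
  end.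

Fixpoint veval (V : zmodType) (env : seq V) (v : seq int) : V :=
  match env, v with
  | x :: env, c :: v => x *~ c + veval env v
  | _, _ => 0
  end.

Lemma veval_nil (V : zmodType) (env : seq V) : veval env [::] = 0.
Proof. by case: env. Qed.

Lemma veval_add (V : zmodType) (env : seq V) u v :
  veval env (vadd u v) = veval env u + veval env v.
Proof.
elim: env u v => [|x env IH] [|a u] [|b v] /=; rewrite ?add0r ?addr0 //.
by rewrite IH mulrzDr addrACA.
Qed.

Lemma veval_scale (V : zmodType) (env : seq V) k u :
  veval env (vscale k u) = veval env u *~ k.
Proof.
elim: env u => [|x env IH] [|a u] /=; rewrite ?mul0rz //.
by rewrite IH mulrzDl mulrzA.
Qed.

Lemma veval_norm (V : zmodType) (env : seq V) a :
  veval env (anorm a) = aeval env a.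
Proof.
elim: a => [i||a IHa b IHb|a IHa|a IHa n] /=.
- elim: i env => [|i IHi] [|x env] //=; first by rewrite veval_nil addr0.
  by rewrite IHi mulr0z add0r.
- exact: veval_nil.
- by rewrite veval_add IHa IHb.
- by rewrite veval_scale IHa mulrN1z.
- by rewrite veval_scale IHa pmulrn.
Qed.

Section OrderedGroup.

Variable G : tgroup.
Implicit Types x y z : G.

Definition gsign (s : bool) x : Prop := if s then tlt 0 x else tle 0 x.

Lemma gsignB s x y : gsign s (y - x) <-> if s then tlt x y else tle x y.
Proof.
have aux (u v w : G) : tlt u v <-> tlt (u + w) (v + w).
  split; first exact: tlt_add.
  by move/(@tlt_add _ _ _ (- w)); rewrite !addrK.
case: s => /=; first by rewrite (aux _ _ x) add0r subrK.
by rewrite /tle (aux _ _ x) add0r subrK.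
Qed.

Lemma tle_eqVlt x y : tle x y <-> tlt x y \/ x = y.
Proof.
split; first by case: (tlt_total x y) => [|[]]; [left|right|].
case=> [xy yx|->]; last exact: tlt_irr.
exact: (@tlt_irr _ x) (tlt_trans xy yx).
Qed.

Lemma gsignD s s' x y : gsign s x -> gsign s' y -> gsign (s || s') (x + y).
Proof.
have add0 (u v : G) : tlt 0 u -> tlt 0 v -> tlt 0 (u + v).
  by move=> u0 v0; apply: tlt_trans v0 _; rewrite -{1}[v]add0r; apply: tlt_add.
have l0 (u : G) : tle 0 u <-> tlt 0 u \/ u = 0.
  by rewrite tle_eqVlt; split=> -[]; [left|right|left|right].
case: s; case: s' => /=; rewrite ?l0.
- exact: add0.
- by move=> x0 [y0|->]; [apply: add0|rewrite addr0].
- by move=> [x0|->] y0; [apply: add0|rewrite add0r].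
- move=> [x0|->] [y0|->]; rewrite ?addr0 ?add0r; [left; exact: add0|by left..|].
  by right.
Qed.

Lemma gsignMn s x n : (0 < n)%N -> gsign s x -> gsign s (x *+ n).
Proof.
case: n => // n _ sx; elim: n => // n IHn.
by rewrite mulrS -[s]orbb; apply: gsignD.
Qed.

(* A pair [(s, v)] stands for the constraint [0 < v] if [s], for [0 <= v] otherwise. *)
Fixpoint all_hold (env : seq G) (cs : seq (bool * seq int)) : Prop :=
  if cs is c :: cs then gsign c.1 (veval env c.2) /\ all_hold env cs else True.

Definition vhead (v : seq int) : int := head 0 v.

(** When the leading coefficients have opposite signs, scaling each constraint by the absolute value
    of the other's coefficient makes them cancel in the sum. *)
Definition combine (c d : bool * seq int) : bool * seq int :=
  (c.1 || d.1, vadd (vscale `|vhead d.2|%N%:Z (behead c.2))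
                    (vscale `|vhead c.2|%N%:Z (behead d.2))).

Definition eliminate (cs : seq (bool * seq int)) : seq (bool * seq int) :=
  [seq (c.1, behead c.2) | c <- cs & vhead c.2 == 0] ++
  flatten [seq [seq combine c d | d <- cs & vhead d.2 < 0]
          | c <- cs & 0 < vhead c.2].

Lemma all_hold_In env cs : all_hold env cs <->
  forall c, c \in cs -> gsign c.1 (veval env c.2).
Proof.
elim: cs => [|c cs IH] //=; split.
  by move=> [h /IH hs] d; rewrite inE => /orP[/eqP->|/hs].
move=> h; split; first by apply: h; rewrite mem_head.
by apply/IH => d dcs; apply: h; rewrite inE dcs orbT.
Qed.

Lemma veval_behead x env v :
  veval (x :: env) v = x *~ vhead v + veval env (behead v).
Proof. by case: v => //=; rewrite mulr0z veval_nil addr0. Qed.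

Lemma all_hold_eliminate x env cs :
  all_hold (x :: env) cs -> all_hold env (eliminate cs).
Proof.
move/all_hold_In => h; apply/all_hold_In => c; rewrite mem_cat => /orP[|].
  move=> /mapP[d]; rewrite mem_filter => /andP[/eqP d0 /h]; rewrite veval_behead.
  by rewrite d0 mulr0z add0r => hd ->.
move=> /flatten_mapP[p]; rewrite mem_filter => /andP[p0 /h hp].
move=> /mapP[n]; rewrite mem_filter => /andP[n0 /h hn] -> /=.
move: hp hn; rewrite !veval_behead veval_add !veval_scale.
set a := vhead p.2 in p0 *; set b := vhead n.2 in n0 *.
set u := veval _ _; set v := veval _ _ => hp hn.
have {hp}: gsign p.1 ((x *~ a + u) *+ `|b|%N).
  by apply: gsignMn => //; rewrite absz_gt0 lt_eqF.
have {hn}: gsign n.1 ((x *~ b + v) *+ `|a|%N).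
  by apply: gsignMn => //; rewrite absz_gt0 gt_eqF.
move=> hn hp; have := gsignD hp hn; congr (gsign _ _).
rewrite !pmulrn !mulrzDl -!mulrzA addrACA -mulrzDr.
suff -> : a * `|b|%N%:Z + b * `|a|%N%:Z = 0 by rewrite mulr0z add0r.
by rewrite !abszE (gtr0_norm p0) (ltr0_norm n0) mulrN [b * a]mulrC addNr.
Qed.

(** Once all variables are gone, each constraint reads [0 < 0] or [0 <= 0], so any strict one is a
    contradiction. *)
Fixpoint refuted (n : nat) (cs : seq (bool * seq int)) : bool :=
  if n is m.+1 then refuted m (eliminate cs)
  else has (fun c => c.1) cs.

Lemma refutedP env cs : refuted (size env) cs -> ~ all_hold env cs.
Proof.
elim: env cs => [|x env IH] cs /= r; last first.
  by move/all_hold_eliminate; apply: IH.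
move/hasP: r => [c ccs c1] /all_hold_In /(_ c ccs); rewrite c1 /=.
exact: tlt_irr.
Qed.

(** A curried chain of hypotheses ending in [False], convertible with the goal that the tactic faces
    after reverting the order hypotheses. *)
Fixpoint inconsistent (env : seq G) (cs : seq (bool * (aexp * aexp))) : Prop :=
  if cs is (s, (a, b)) :: cs then
    (if s then tlt (aeval env a) (aeval env b)
     else tle (aeval env a) (aeval env b)) -> inconsistent env cs
  else False.

Lemma inconsistentP cs env n : n = size env ->
  refuted n [seq (c.1, anorm (AAdd c.2.2 (AOpp c.2.1))) | c <- cs] ->
  inconsistent env cs.
Proof.
move=> -> /refutedP; elim: cs => [|[s [a b]] cs IH] /=; first by apply.
move=> h sab; apply: IH => hs; apply: h; split => //.
by rewrite veval_add veval_scale !veval_norm mulrN1z; apply/gsignB.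
Qed.

Lemma tle_eq x y : x = y -> tle x y /\ tle y x.
Proof. by move->; split; apply: tlt_irr. Qed.

Lemma tle_anti x y : tle x y -> tle y x -> x = y.
Proof. by move=> xy yx; case: (tlt_total x y) => [|[]]. Qed.

Lemma tltNge x y : ~ tle y x -> tlt x y.
Proof. exact: contrapT. Qed.

End OrderedGroup.

(** Only multiples by a literal count as linear; any other multiple, such as [one G *+ n] for a
    variable [n], is treated as an atom. *)
Ltac nat_literal n :=
  lazymatch n with O => idtac | S ?m => nat_literal m end.

Ltac atom_index x l :=
  match l with
  | ?y :: _ => let _ := match l with _ => unify x y end in constr:(O)
  | _ :: ?l => let i := atom_index x l in constr:(S i)
  end.

Ltac add_atom x l :=
  match l with
  | _ => let i := atom_index x l in l
  | ?y :: ?l' => let m := add_atom x l' in constr:(y :: m)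
  | nil => constr:([:: x])
  end.

Ltac atoms_of t l :=
  match t with
  | @GRing.add _ ?a ?b => let l := atoms_of a l in atoms_of b l
  | @GRing.opp _ ?a => atoms_of a l
  | @GRing.zero _ => l
  | @GRing.natmul _ ?a ?n =>
      let _ := match t with _ => nat_literal n end in atoms_of a l
  | _ => add_atom t l
  end.

Ltac reify_term t l :=
  match t with
  | @GRing.add _ ?a ?b =>
      let u := reify_term a l in let v := reify_term b l in constr:(AAdd u v)
  | @GRing.opp _ ?a => let u := reify_term a l in constr:(AOpp u)
  | @GRing.zero _ => constr:(AZero)
  | @GRing.natmul _ ?a ?n =>
      let _ := match t with _ => nat_literal n end in
      let u := reify_term a l in constr:(AMuln u n)
  | _ => let i := atom_index t l in constr:(AVar i)
  end.

Ltac atoms_of_goal g l :=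
  lazymatch g with
  | @tlt _ ?x ?y -> ?h =>
      let l := atoms_of x l in let l := atoms_of y l in atoms_of_goal h l
  | @tle _ ?x ?y -> ?h =>
      let l := atoms_of x l in let l := atoms_of y l in atoms_of_goal h l
  | False => l
  end.

Ltac reify_goal g l :=
  lazymatch g with
  | @tlt _ ?x ?y -> ?h =>
      let u := reify_term x l in let v := reify_term y l in
      let r := reify_goal h l in constr:((true, (u, v)) :: r)
  | @tle _ ?x ?y -> ?h =>
      let u := reify_term x l in let v := reify_term y l in
      let r := reify_goal h l in constr:((false, (u, v)) :: r)
  | False => constr:(@nil (bool * (aexp * aexp)))
  end.

Ltac fourier_motzkin :=
  match goal with
  | |- ?g =>
    let G := match g with
             | context [@tlt ?G _ _] => G
             | context [@tle ?G _ _] => G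
             end in
      let l := atoms_of_goal g (@nil (car G)) in
      let n := eval compute in (size l) in
      let cs := reify_goal g l in
      exact (@inconsistentP G cs l n erefl isT)
  end.

Ltac revert_order :=
  repeat match goal with
  | H : @eq (Algebra.BaseAddUMagma.sort _) ?x ?y |- _ =>
      apply tle_eq in H; destruct H
  | H : @eq (Algebra.Zmodule.sort _) ?x ?y |- _ => apply tle_eq in H; destruct H
  end;
  repeat match goal with
  | H : ~ tle _ _ |- _ => apply tltNge in H
  | H : tle _ _ -> False |- _ => apply tltNge in H
  | H : tlt _ _ |- _ => revert H
  | H : tle _ _ |- _ => revert H
  | H : ~ @tlt ?G ?x ?y |- _ => change (@tle G y x) in H; revert H
  | H : @tlt ?G ?x ?y -> False |- _ => change (@tle G y x) in H; revert H
  end.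

Ltac ordered_group :=
  match goal with
  | |- tlt _ _ => apply: tltNge; let H := fresh in intro H; revert_order; fourier_motzkin
  | |- tle _ _ => let H := fresh in intro H; revert_order; fourier_motzkin
  | |- ~ tlt _ _ => let H := fresh in intro H; revert_order; fourier_motzkin
  | |- ~ tle _ _ => let H := fresh in intro H; revert_order; fourier_motzkin
  | |- @eq _ _ _ => apply: tle_anti; ordered_group
  | |- _ => exfalso; revert_order; fourier_motzkin
  end.

(** * Integers, the convex subgroup and Euclidean division *)

Section IntegerPart.

Variable G : tgroup.
Implicit Types x y z e : G.

Lemma tle_refl x : tle x x.
Proof. exact: tlt_irr. Qed.

Lemma tlt_pMn2r n x y : tlt (x *+ n.+1) (y *+ n.+1) <-> tlt x y.
Proof.
have aux (u v : G) : tlt u v -> tlt (u *+ n.+1) (v *+ n.+1).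
  by move=> /(gsignB true)/gsignMn h; apply/(gsignB true); rewrite -mulrnBl; apply: h.
split; last exact: aux.
move=> h; case: (tlt_total x y) => [//|[e|/aux yx]]; last by ordered_group.
by move: h; rewrite e => /tlt_irr.
Qed.

Lemma tle_pMn2r n x y : tle (x *+ n.+1) (y *+ n.+1) <-> tle x y.
Proof. by rewrite /tle tlt_pMn2r. Qed.

Lemma mulIrn_pos n x y : x *+ n.+1 = y *+ n.+1 -> x = y.
Proof.
by move=> e; apply: tle_anti; apply/(@tle_pMn2r n); rewrite e; apply: tle_refl.
Qed.

Lemma isZB x y : isZ x -> isZ y -> isZ (x - y).
Proof. by move=> Zx Zy; apply: isZD Zx (isZN Zy). Qed.

Lemma isZMn x n : isZ x -> isZ (x *+ n).
Proof. by move=> Zx; elim: n => [|n IH]; [exact: isZ0|rewrite mulrS; exact: isZD]. Qed.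

Lemma isZMz x (k : int) : isZ x -> isZ (x *~ k).
Proof. by move=> Zx; case: k => n; [|apply: isZN]; apply: isZMn. Qed.

Lemma isLB x y : isL x -> isL y -> isL (x - y).
Proof. by move=> Lx Ly; apply: isLD Lx (isLN Ly). Qed.

Lemma isLMn x n : isL x -> isL (x *+ n).
Proof. by move=> Lx; elim: n => [|n IH]; [exact: isL0|rewrite mulrS; exact: isLD]. Qed.

Lemma isLMz x (k : int) : isL x -> isL (x *~ k).
Proof. by move=> Lx; case: k => n; [|apply: isLN]; apply: isLMn. Qed.

Lemma isL_le x y : isL y -> tle 0 x -> tle x y -> isL x.
Proof. by move=> Ly x0 xy; exact: (isL_convex (isL0 G) Ly x0 xy). Qed.

Lemma isL_addr x y : isL y -> isL (x + y) <-> isL x.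
Proof.
by move=> Ly; split=> h; [rewrite -[x](addrK y); apply: isLB|apply: isLD].
Qed.

Lemma isL_opp x : isL (- x) <-> isL x.
Proof. by split=> /isLN; rewrite ?opprK. Qed.

(** For [x >= 0] the element [x] lies between 0 and its multiple, so convexity applies; negative
    elements follow by symmetry. *)
Lemma isL_pMn n x : isL (x *+ n.+1) <-> isL x.
Proof.
split; last exact: isLMn.
have aux (u : G) : tle 0 u -> isL (u *+ n.+1) -> isL u.
  move=> u0 Lu; apply: (isL_le Lu) => //; elim: n {Lu} => [|n IH]; rewrite ?mulrS ?addr0.
    exact: tle_refl.
  by rewrite mulrS in IH; ordered_group.
case: (EM (tle 0 x)) => [x0|]; first exact: aux.
move/contrapT => x0 /isLN; rewrite -mulNrn => Lx; apply/isL_opp/aux => //.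
by ordered_group.
Qed.

(** Otherwise [x - y] would be an element of [Z] strictly between 0 and 1. *)
Lemma isZ_ltS x y : isZ x -> isZ y -> tlt x (y + one G) -> tle x y.
Proof.
move=> Zx Zy xy yx; have yx' : tlt 0 (x - y) by ordered_group.
by apply: (isZ_least (isZB Zx Zy) yx'); ordered_group.
Qed.

(** [Z] may have nonstandard elements, but discreteness excludes them from a standard interval; this
    is what permits finite disjunctions over numerals later. *)
Lemma isZ_numeral x n : isZ x -> tle 0 x -> tlt x (one G *+ n) ->
  exists2 k, (k < n)%N & x = one G *+ k.
Proof.
move=> Zx x0; elim: n => [|n IH] h; first by rewrite mulr0n in h; ordered_group.
have [/IH[k kn ->]|h'] := EM (tlt x (one G *+ n)); first by exists k => //; apply: ltnW.
exists n => //; apply: tle_anti; last exact: h'.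
apply: isZ_ltS => //.
  by apply: isZMn; apply: isZ1.
by rewrite mulrS in h; ordered_group.
Qed.

Lemma floor_ex x : exists z, [/\ isZ z, tle z x & tlt x (z + one G)].
Proof.
have [n [Zn h1 h2]] := isZ_part x; have o0 := one_gt0 G.
(* As [n - 1 <= x <= n + 1], the floor is [n - 1], [n] or [n + 1], the last only if [x = n + 1]. *)
have [h|h] := EM (tlt x n).
  exists (n - one G); split; first exact: isZB Zn (isZ1 G).
    by ordered_group.
  by ordered_group.
have [h'|h'] := EM (tlt x (n + one G)); first by exists n.
exists (n + one G); split; first exact: isZD Zn (isZ1 G).
  by ordered_group.
by ordered_group.
Qed.

Definition tfloor x : G := sval (cid (floor_ex x)).

Lemma tfloorP x : [/\ isZ (tfloor x), tle (tfloor x) x & tlt x (tfloor x + one G)].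
Proof. exact: (svalP (cid (floor_ex x))). Qed.

Lemma tfloor_unique x z : isZ z -> tle z x -> tlt x (z + one G) -> tfloor x = z.
Proof.
move=> Zz zx xz; have [Zf fx xf] := tfloorP x.
by apply: tle_anti; apply: isZ_ltS => //; ordered_group.
Qed.

(* Division by [n.+1], so that it is total. *)
Definition tdivS x n : G := sval (cid (tdiv_ex x (ltn0Sn n))).

Lemma tdivSK x n : tdivS x n *+ n.+1 = x.
Proof. exact: (svalP (cid (tdiv_ex x (ltn0Sn n)))). Qed.

(** Euclidean division, with [w] the floor of [(z - y) / d.+1], available because the group is
    divisible. It moves [z] within its congruence class into a window that starts at an arbitrary
    [y]. *)
Lemma isZ_window d y z : isZ z -> exists w,
  [/\ isZ w, tle y (z - w *+ d.+1) & tlt (z - w *+ d.+1) (y + one G *+ d.+1)].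
Proof.
move=> Zz; pose u := tdivS (z - y) d; have uE : u *+ d.+1 = z - y by exact: tdivSK.
have [Zw wu uw] := tfloorP u; exists (tfloor u); split => //.
  by move: wu => /(@tle_pMn2r d); rewrite uE => h; ordered_group.
by move: uw => /(@tlt_pMn2r d); rewrite uE mulrnDl => h; ordered_group.
Qed.

Lemma one_ge0 n : tle 0 (one G *+ n).
Proof.
elim: n => [|n IH]; first exact: tle_refl.
by rewrite mulrS; have o0 := one_gt0 G; ordered_group.
Qed.

(** A point [e] separating [x] from [y] would, by convexity, lie in their common coset modulo
    [L]. *)
Lemma tle_coset x y e : isL (x - y) -> ~ isL (y - e) -> tle e x <-> tle e y.
Proof.
have aux (u v : G) : isL (u - v) -> ~ isL (v - e) -> tle e u -> tle e v.
  move=> Luv h eu ve; apply: h; rewrite -[v - e]opprB; apply/isL_opp.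
  by apply: (isL_le Luv); ordered_group.
move=> Lxy Lye; split; first exact: aux.
apply: aux; first by rewrite -opprB; apply/isL_opp.
by move=> Lxe; apply: Lye; rewrite (_ : y - e = (x - e) - (x - y)); [exact: isLB|ordered_group].
Qed.

Lemma max_ex (T : eqType) (f : T -> G) (P : T -> Prop) (s : seq T) :
  (exists2 a, a \in s & P a) ->
  exists a, [/\ a \in s, P a & forall b, b \in s -> P b -> tle (f b) (f a)].
Proof.
elim: s => [[]//|a s IH] [a0 a0s Pa0].
have [[b bs Pb]|none] := EM (exists2 b, b \in s & P b).
  have [c [cs Pc cmax]] := IH (ex_intro2 _ _ b bs Pb).
  have [[Pa ca]|h] := EM (P a /\ tle (f c) (f a)).
    exists a; split=> //; first exact: mem_head.
    move=> d; rewrite in_cons => /predU1P[->|ds Pd]; first by move=> _; apply: tle_refl.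
    by have := cmax _ ds Pd; move=> dc; ordered_group.
  exists c; split=> //; first by rewrite in_cons cs orbT.
  move=> d; rewrite in_cons => /predU1P[->|ds Pd]; last exact: cmax.
  by move=> Pa ca; apply: h; split => //; ordered_group.
have a0E : a0 = a.
  by move: a0s; rewrite in_cons => /predU1P[//|a0s]; case: none; exists a0.
exists a; rewrite mem_head -a0E; split=> // d; rewrite in_cons => /predU1P[->|ds Pd].
  by move=> _; apply: tle_refl.
by case: none; exists d.
Qed.

Lemma min_ex (T : eqType) (f : T -> G) (P : T -> Prop) (s : seq T) :
  (exists2 a, a \in s & P a) ->
  exists a, [/\ a \in s, P a & forall b, b \in s -> P b -> tle (f a) (f b)].
Proof.
move/(max_ex (fun a => - f a)) => [a [sa Pa amax]]; exists a; split=> // b bs Pb.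
by have h := amax b bs Pb; ordered_group.
Qed.

End IntegerPart.

(** * Elimination of a fractional part *)

(** A linear polynomial: coefficients paired with variables, and a constant. A variable may occur
    repeatedly, so its coefficient is a sum. *)
Notation lterm := (seq (int * nat) * int)%type.

Definition lcoef0 (t : lterm) : int := foldr (fun p c => if p.2 == 0%N then p.1 + c else c) 0 t.1.

Definition lrest (t : lterm) : lterm :=
  ([seq (p.1, p.2.-1) | p <- t.1 & p.2 != 0%N], t.2).

Definition lscale (k : int) (t : lterm) : lterm :=
  ([seq (p.1 * k, p.2) | p <- t.1], t.2 * k).

Definition ladd (t u : lterm) : lterm := (t.1 ++ u.1, t.2 + u.2).

Definition lconst (k : int) : lterm := ([::], k).

Section LinearTerms.

Variable G : tgroup.
Implicit Types e : nat -> G.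

Definition lsum e (s : seq (int * nat)) : G :=
  foldr (fun p x => e p.2 *~ p.1 + x) 0 s.

Definition leval e (t : lterm) : G := lsum e t.1 + one G *~ t.2.

Lemma leval_scons x e t :
  leval (scons x e) t = x *~ lcoef0 t + leval e (lrest t).
Proof.
case: t => s n; rewrite /leval /lcoef0 /lrest /= addrA; congr (_ + _).
elim: s => [|[k [|i]] s IH] /=; rewrite ?mulr0z ?addr0 //.
  by rewrite IH mulrzDr addrA.
by rewrite IH addrCA.
Qed.

Lemma leval_scale e k t : leval e (lscale k t) = leval e t *~ k.
Proof.
case: t => s n; rewrite /leval /= mulrzDl mulrzA; congr (_ + _).
by elim: s => [|[a i] s IH] /=; rewrite ?mul0rz // mulrzDl IH mulrzA.
Qed.

Lemma leval_add e t u : leval e (ladd t u) = leval e t + leval e u.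
Proof.
case: t => s n; case: u => s' n'; rewrite /leval /= mulrzDr addrACA; congr (_ + _).
by elim: s => [|[a i] s IH] /=; rewrite ?add0r // IH addrA.
Qed.

Lemma leval_const e k : leval e (lconst k) = one G *~ k.
Proof. by rewrite /leval add0r. Qed.

Lemma isZ_leval e t : (forall i, isZ (e i)) -> isZ (leval e t).
Proof.
move=> Ze; case: t => s n; apply: isZD; last exact: isZMz (isZ1 G).
by elim: s => [|[k i] s IH] /=; [exact: isZ0|apply: isZD => //; apply: isZMz].
Qed.

(* A pair [(c, t)] denotes the point [t / c.+1]. *)
Definition lpoint e (p : nat * lterm) : G := tdivS (leval e p.2) p.1.

Lemma lpointK e p : lpoint e p *+ p.1.+1 = leval e p.2.
Proof. exact: tdivSK. Qed.

End LinearTerms.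

(* The frac and floor atoms are evaluated in two separate environments. *)
Inductive qf :=
  | QFrac of lterm
  | QInt of lterm
  | QMod of nat & lterm
  | QL of lterm
  | QAllL
  | QBot
  | QImp of qf & qf.

Definition QNot p := QImp p QBot.
Definition QAnd p q := QNot (QImp p (QNot q)).
Definition QOr p q := QImp (QNot p) q.
Definition QOrs (qs : seq qf) : qf := foldr QOr QBot qs.

Section QfSemantics.

Variable G : tgroup.

(** The modulus of [QMod m] is [m.+1], hence never zero. *)
Fixpoint qeval (ze fe : nat -> G) (q : qf) : Prop :=
  match q with
  | QFrac t => tle 0 (leval fe t)
  | QInt t => tle 0 (leval ze t)
  | QMod m t => exists2 w, isZ w & leval ze t = w *+ m.+1
  | QL t => isL (leval ze t)
  | QAllL => forall x : G, isL x
  | QBot => False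
  | QImp p q => qeval ze fe p -> qeval ze fe q
  end.

Variables ze fe : nat -> G.

Lemma qeval_Not p : qeval ze fe (QNot p) <-> ~ qeval ze fe p.
Proof. by []. Qed.

Lemma qeval_And p q : qeval ze fe (QAnd p q) <-> qeval ze fe p /\ qeval ze fe q.
Proof.
split=> [h|[hp hq] h]; last exact: h.
by split; apply: contrapT => n; apply: h => hp // hq.
Qed.

Lemma qeval_Or p q : qeval ze fe (QOr p q) <-> qeval ze fe p \/ qeval ze fe q.
Proof.
split=> [h|[hp np|hq _]]; [|by case: (np hp)|exact: hq].
by have [hp|np] := EM (qeval ze fe p); [left|right; apply: h].
Qed.

Lemma qeval_Ors (T : eqType) (f : T -> qf) (s : seq T) :
  qeval ze fe (QOrs [seq f a | a <- s]) <-> exists2 a, a \in s & qeval ze fe (f a).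
Proof.
elim: s => [|a s IH]; first by split=> // -[].
rewrite map_cons [QOrs _]/(QOr (f a) (QOrs [seq f b | b <- s])) qeval_Or IH; split.
  by move=> [h|[b bs h]]; [exists a; rewrite ?mem_head|exists b; rewrite ?in_cons ?bs ?orbT].
by move=> [b]; rewrite in_cons => /predU1P[->|bs]; [left|right; exists b].
Qed.

End QfSemantics.

(** The roots of the linear atoms in the variable 0: the root of [c * x + r] is [- sgz c * r] over
    [|c|], and denominators are stored less one. *)
Fixpoint fcrit (q : qf) : seq (nat * lterm) :=
  match q with
  | QFrac t =>
      if lcoef0 t == 0 then [::]
      else [:: (`|lcoef0 t|%N.-1, lscale (- sgz (lcoef0 t)) (lrest t))]
  | QImp p q => fcrit p ++ fcrit q
  | _ => [::]
  end.

(** Substitutes [u / n.+1] for the variable 0. Each inequality is multiplied by [n.+1] to keep the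
    coefficients integral. *)
Fixpoint fsub (n : nat) (u : lterm) (q : qf) : qf :=
  match q with
  | QFrac t => QFrac (ladd (lscale n.+1%:Z (lrest t)) (lscale (lcoef0 t) u))
  | QImp p q => QImp (fsub n u p) (fsub n u q)
  | _ => q
  end.

Section FracElimination.

Variable G : tgroup.
Implicit Types x y : G.

Lemma leval_sub (e : nat -> G) n u t x : x *+ n.+1 = leval e u ->
  leval e (ladd (lscale n.+1%:Z (lrest t)) (lscale (lcoef0 t) u)) =
  leval (scons x e) t *+ n.+1.
Proof.
move=> xu; rewrite leval_add !leval_scale leval_scons -xu mulrnDl addrC.
by rewrite !pmulrn mulrzAC.
Qed.

Lemma qeval_fsub (ze fe : nat -> G) n u q x : x *+ n.+1 = leval fe u ->
  qeval ze fe (fsub n u q) <-> qeval ze (scons x fe) q.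
Proof.
move=> xu; elim: q => //= [t|p IHp q IHq]; last by rewrite IHp IHq.
by rewrite (leval_sub _ xu) -[X in tle X _](mul0rn _ n.+1) tle_pMn2r.
Qed.

Lemma fcrit_sound (ze fe : nat -> G) q x y :
  (forall p, p \in fcrit q ->
    (tle (lpoint fe p) x <-> tle (lpoint fe p) y) /\
    (tle x (lpoint fe p) <-> tle y (lpoint fe p))) ->
  qeval ze (scons x fe) q <-> qeval ze (scons y fe) q.
Proof.
elim: q => //= [t|p IHp q IHq] crit; last first.
  rewrite IHp => [|r rp]; last by apply: crit; rewrite mem_cat rp.
  by rewrite IHq => // r rq; apply: crit; rewrite mem_cat rq orbT.
rewrite !leval_scons; set c := lcoef0 t in crit *.
case cE : c crit => [[|n]|n] crit; first by rewrite !mulr0z.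
  have [] := crit _ (mem_head _ _); have := lpointK fe (n, lscale (- sgz (Posz n.+1)) (lrest t)).
  rewrite /= leval_scale; set e := lpoint _ _ => eE h1 _.
  rewrite mulrN1z in eE.
  have aux (z : G) : tle 0 (z *~ Posz n.+1 + leval fe (lrest t)) <-> tle e z.
    by rewrite -(tle_pMn2r n e z) eE -pmulrn; split=> h; ordered_group.
  by rewrite !aux.
have [] := crit _ (mem_head _ _); have := lpointK fe (n, lscale (- sgz (Negz n)) (lrest t)).
rewrite /= leval_scale mulr1z; set e := lpoint _ _ => eE _ h1.
have aux (z : G) : tle 0 (z *~ Negz n + leval fe (lrest t)) <-> tle z e.
  by rewrite -(tle_pMn2r n z e) eE NegzE mulrNz -pmulrn; split=> h; ordered_group.
by rewrite !aux.
Qed.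

End FracElimination.

(** The midpoint over a common denominator. For [p = r] it has the value of [p] itself, so critical
    points are tested too. *)
Definition fmid (p r : nat * lterm) : nat * lterm :=
  ((2 * p.1.+1 * r.1.+1).-1,
   ladd (lscale r.1.+1%:Z p.2) (lscale p.1.+1%:Z r.2)).

Definition fguard : qf :=
  QAnd (QFrac ([:: (1, 0%N)], 0)) (QNot (QFrac ([:: (1, 0%N)], -1))).

Definition felim (q : qf) : qf :=
  let q1 := QAnd q fguard in
  (* The points 0 and 1 ensure that every [x] in range has critical points on both sides; the guard
     rejects test points out of range. *)
  let E := [:: (0%N, lconst 0), (0%N, lconst 1) & fcrit q1] in
  QOrs [seq let m := fmid pr.1 pr.2 in fsub m.1 m.2 q1 | pr <- [seq (p, r) | p <- E, r <- E]].

(** Given a solution [x], take the largest critical point below or at [x] and the smallest above or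
    at [x]: their midpoint compares with all critical points as [x] does. *)
Lemma felimP (G : tgroup) (ze fe : nat -> G) q :
  qeval ze fe (felim q) <->
  exists x, [/\ tle 0 x, tlt x (one G) & qeval ze (scons x fe) q].
Proof.
rewrite /felim; set q1 := QAnd q fguard; set E := _ :: _.
have q1E x : qeval ze (scons x fe) q1 <->
    [/\ tle 0 x, tlt x (one G) & qeval ze (scons x fe) q].
  have n0 : x *~ 1 + 0 + one G *~ 0 = x by rewrite mulr0z mulr1z !addr0.
  have n1 : x *~ 1 + 0 + one G *~ -1 = x - one G by rewrite mulrN1z mulr1z !addr0.
  rewrite !qeval_And /= /leval /= n0 n1; split=> [[h [h1 h2]]|[h1 h2 h]].
    by split=> //; ordered_group.
  by do !split=> //; move=> h3; ordered_group.
rewrite qeval_Ors; split.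
  move=> [[p r] _] /=; set m := fmid p r => h.
  exists (tdivS (leval fe m.2) m.1); apply/q1E.
  by rewrite -(qeval_fsub _ _ (tdivSK _ _)).
move=> [x /q1E xq].
have [x0 x1 _] := (q1E x).1 xq.
pose f := lpoint fe.
have f0 : f (0%N, lconst 0) = 0.
  by rewrite -[LHS]mulr1n lpointK leval_const mulr0z.
have f1 : f (0%N, lconst 1) = one G.
  by rewrite -[LHS]mulr1n lpointK leval_const.
have [p [pE px pmax]] : exists a, [/\ a \in E, tle (f a) x &
    forall b, b \in E -> tle (f b) x -> tle (f b) (f a)].
  by apply: max_ex; exists (0%N, lconst 0); rewrite ?f0 // mem_head.
have [r [rE rx rmin]] : exists a, [/\ a \in E, tle x (f a) &
    forall b, b \in E -> tle x (f b) -> tle (f a) (f b)].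
  apply: min_ex; exists (0%N, lconst 1); last by rewrite f1; ordered_group.
  by rewrite !in_cons eqxx orbT.
exists (p, r); first by apply/allpairsP; exists (p, r).
change (qeval ze fe (fsub (fmid p r).1 (fmid p r).2 q1)).
pose y := tdivS (f p + f r) 1.
have yE : y *+ 2 = f p + f r by exact: tdivSK.
have yK : y *+ (fmid p r).1.+1 = leval fe (fmid p r).2.
  have -> : (fmid p r).1.+1 = (2 * p.1.+1 * r.1.+1)%N by rewrite prednK.
  rewrite -mulnA mulrnA yE leval_add !leval_scale -!lpointK -/(f p) -/(f r).
  by rewrite mulrnDl -!pmulrn -!mulrnA [(r.1.+1 * _)%N]mulnC.
rewrite (qeval_fsub _ _ yK).
suff -> : qeval ze (scons y fe) q1 <-> qeval ze (scons x fe) q1 by [].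
apply: fcrit_sound => a aq.
have aE : a \in E by rewrite !in_cons aq !orbT.
rewrite -/(f a); split; split => h.
- have [//|h'] := EM (tle (f a) x).
  have h1 : tle x (f a) by ordered_group.
  by have h2 := rmin a aE h1; ordered_group.
- by have h1 := pmax a aE h; ordered_group.
- have [//|h'] := EM (tle x (f a)).
  have h1 : tle (f a) x by ordered_group.
  by have h2 := pmax a aE h1; ordered_group.
- by have h1 := rmin a aE h; ordered_group.
Qed.

(** * Elimination of an integer part *)

(* Over [Z], an upper bound [x <= r / n] is the negation of the lower bound
   [x >= (r + 1) / n]; so only lower bounds are recorded. *)
Fixpoint zcrit (q : qf) : seq (nat * lterm) :=
  match q with
  | QInt t =>
      match lcoef0 t with
      | Posz 0 => [::]
      | Posz n.+1 => [:: (n, lscale (-1) (lrest t))]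
      | Negz n => [:: (n, ladd (lrest t) (lconst 1))]
      end
  | QL t =>
      match lcoef0 t with
      | Posz 0 => [::]
      | Posz n.+1 => [:: (n, lscale (-1) (lrest t))]
      | Negz n => [:: (n, lrest t)]
      end
  | QImp p q => zcrit p ++ zcrit q
  | _ => [::]
  end.

Fixpoint zmod (q : qf) : nat :=
  match q with
  | QMod m _ => m.+1
  | QImp p q => zmod p * zmod q
  | _ => 1
  end.

(** Like [fsub], with denominators cleared; in a congruence the modulus is multiplied by [n.+1] as
    well. *)
Fixpoint zsub (n : nat) (u : lterm) (q : qf) : qf :=
  let sub t := ladd (lscale n.+1%:Z (lrest t)) (lscale (lcoef0 t) u) in
  match q with
  | QInt t => QInt (sub t)
  | QMod m t => QMod (n.+1 * m.+1).-1 (sub t)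
  | QL t => QL (sub t)
  | QImp p q => QImp (zsub n u p) (zsub n u q)
  | _ => q
  end.

(** A positive multiple of the difference of the points [p] and [r], free of denominators. *)
Definition lcross (p r : nat * lterm) : lterm :=
  ladd (lscale r.1.+1%:Z p.2) (lscale (- p.1.+1%:Z) r.2).

(* [vge o r] says that the point [r] is below the virtual point [o], where
   [None] stands for -oo and [Some p] for a point that lies above all of [p + L]
   but below all the other critical points above [p + L]. *)
Definition vge (o : option (nat * lterm)) (r : nat * lterm) : qf :=
  if o is Some p then QOr (QInt (lcross p r)) (QL (lcross p r)) else QBot.

(* Substitution of an integer near the virtual point [o], congruent to [k]
   modulo [zmod q], for the variable 0. *)
Fixpoint vsub (o : option (nat * lterm)) (k : nat) (q : qf) : qf :=
  match q with
  | QInt t =>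
      match lcoef0 t with
      | Posz 0 => QInt (lrest t)
      | Posz n.+1 => vge o (n, lscale (-1) (lrest t))
      | Negz n => QNot (vge o (n, ladd (lrest t) (lconst 1)))
      end
  | QL t => if lcoef0 t == 0 then QL (lrest t) else QBot
  | QMod m t => QMod m (ladd (lrest t) (lconst (lcoef0 t * k%:Z)))
  | QImp p q => QImp (vsub o k p) (vsub o k q)
  | _ => q
  end.

(** [near p k] tests the point [p - D + k / p.1.+1], and its [QMod] conjunct requires this point to
    be in [Z]; the range of [k] covers the interval from [p - D] to [p + D]. The point 0 is included
    in [E] so that every integer is near a critical point when [L] is everything. *)
Definition zelim (q : qf) : qf :=
  let E := (0%N, lconst 0) :: zcrit q in
  let D := zmod q in
  let near (p : nat * lterm) (k : nat) :=
    let u := ladd p.2 (lconst (k%:Z - (p.1.+1 * D)%N%:Z)) in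
    QAnd (QMod p.1 u) (zsub p.1 u q) in
  QOr (QOrs [seq QOrs [seq near p k | k <- iota 0 (2 * (p.1.+1 * D))] | p <- E])
      (QAnd (QNot QAllL)
        (QOrs [seq QOrs [seq vsub o k q | k <- iota 0 D] | o <- None :: map some E])).

Lemma zmod_gt0 q : (0 < zmod q)%N.
Proof. by elim: q => //= p Hp q Hq; rewrite muln_gt0 Hp. Qed.

Section IntElimination.

Variables (G : tgroup) (ze fe : nat -> G).
Hypothesis Zze : forall i, isZ (ze i).
Implicit Types x y z : G.

Let pt := lpoint ze.

Lemma qeval_zsub n u q x : x *+ n.+1 = leval ze u ->
  qeval ze fe (zsub n u q) <-> qeval (scons x ze) fe q.
Proof.
move=> xu; elim: q => //= [t|m t|t|p IHp q IHq]; last by rewrite IHp IHq.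
- by rewrite (leval_sub _ xu) -[X in tle X _](mul0rn _ n.+1) tle_pMn2r.
- rewrite (leval_sub _ xu); split=> -[w Zw wE]; exists w => //.
    by apply: (@mulIrn_pos _ n); rewrite wE -mulrnA [(m.+1 * _)%N]mulnC.
  by rewrite wE -mulrnA [(m.+1 * _)%N]mulnC.
- by rewrite (leval_sub _ xu) isL_pMn.
Qed.

Lemma int_lower n t x : tle 0 (x *~ Posz n.+1 + leval ze t) <->
  tle (pt (n, lscale (-1) t)) x.
Proof.
have := lpointK ze (n, lscale (-1) t); rewrite -/pt /= leval_scale mulrN1z.
by rewrite -(tle_pMn2r n (pt _)) => ->; rewrite -pmulrn; split=> h; ordered_group.
Qed.

Lemma int_upper n t x : isZ x -> tle 0 (x *~ Negz n + leval ze t) <->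
  ~ tle (pt (n, ladd t (lconst 1))) x.
Proof.
have := lpointK ze (n, ladd t (lconst 1)); rewrite -/pt /= leval_add leval_const mulr1z.
move=> E Zx; rewrite -(tle_pMn2r n (pt _)) E NegzE mulrNz -pmulrn.
have o0 := one_gt0 G.
split=> h; first by move=> h'; ordered_group.
have {}h : tle (x *+ n.+1) (leval ze t).
  by apply: isZ_ltS; [exact: isZMn|exact: isZ_leval|ordered_group].
by ordered_group.
Qed.

Lemma isL_lower n t x : isL (x *~ Posz n.+1 + leval ze t) <->
  isL (x - pt (n, lscale (-1) t)).
Proof.
have := lpointK ze (n, lscale (-1) t); rewrite -/pt /= leval_scale mulrN1z.
by rewrite -(isL_pMn n (_ - _)) mulrnBl => ->; rewrite opprK -pmulrn.
Qed.

Lemma isL_upper n t x : isL (x *~ Negz n + leval ze t) <-> isL (x - pt (n, t)).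
Proof.
have := lpointK ze (n, t); rewrite -/pt /= => E.
by rewrite -(isL_pMn n (_ - _)) mulrnBl E -isL_opp opprD opprK.
Qed.

Lemma zcrit_sound D q x y : isZ x -> isZ y -> (zmod q %| D)%N ->
  (exists2 w, isZ w & x = y + w *+ D) ->
  (forall p, p \in zcrit q ->
    (tle (pt p) x <-> tle (pt p) y) /\ (isL (x - pt p) <-> isL (y - pt p))) ->
  qeval (scons x ze) fe q <-> qeval (scons y ze) fe q.
Proof.
move=> Zx Zy; elim: q => //= [t|m t|t|p IHp q IHq].
- move=> _ _ crit; rewrite !leval_scons.
  case: lcoef0 crit => [[|n]|n] crit; first by rewrite !mulr0z.
    by rewrite !int_lower; case: (crit _ (mem_head _ _)).
  by rewrite !int_upper //; case: (crit _ (mem_head _ _)) => -> _.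
- move=> /dvdnP[d ->] [w Zw ->] _; rewrite !leval_scons.
  set c := lcoef0 t; have cE : (y + w *+ (d * m.+1)) *~ c + leval ze (lrest t) =
    y *~ c + leval ze (lrest t) + (w *+ d) *~ c *+ m.+1.
    by rewrite mulrzDl addrAC mulrnA !pmulrn; congr (_ + _); rewrite mulrzAC.
  rewrite cE; split=> -[v Zv vE].
    exists (v - (w *+ d) *~ c); first by apply: isZB => //; apply/isZMz/isZMn.
    by rewrite mulrnBl -vE addrK.
  exists (v + (w *+ d) *~ c); first by apply: isZD => //; apply/isZMz/isZMn.
  by rewrite mulrnDl -vE.
- move=> _ _ crit; rewrite !leval_scons.
  case: lcoef0 crit => [[|n]|n] crit; first by rewrite !mulr0z.
    by rewrite !isL_lower; case: (crit _ (mem_head _ _)).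
  by rewrite !isL_upper; case: (crit _ (mem_head _ _)).
move=> D0 xy crit; rewrite IHp ?IHq //.
- exact: dvdn_trans (dvdn_mull _ (dvdnn _)) D0.
- by move=> r rq; apply: crit; rewrite mem_cat rq orbT.
- exact: dvdn_trans (dvdn_mulr _ (dvdnn _)) D0.
- by move=> r rp; apply: crit; rewrite mem_cat rp.
Qed.

Lemma lcrossE p r : leval ze (lcross p r) = (pt p - pt r) *+ (p.1.+1 * r.1.+1).
Proof.
rewrite leval_add !leval_scale mulrNz -!pmulrn -!lpointK -/pt mulrnBl -!mulrnA.
by rewrite [(r.1.+1 * _)%N]mulnC.
Qed.

Lemma qeval_vge p r : qeval ze fe (vge (Some p) r) <->
  tle (pt r) (pt p) \/ isL (pt p - pt r).
Proof.
rewrite [vge _ _]/(QOr (QInt (lcross p r)) (QL (lcross p r))) qeval_Or /= !lcrossE.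
rewrite mulnC mulrnA isL_pMn -mulrnA mulnC.
rewrite -[X in tle X _](mul0rn _ (p.1.+1 * r.1.+1)) mulSn tle_pMn2r isL_pMn.
by suff -> : tle 0 (pt p - pt r) <-> tle (pt r) (pt p) by []; split=> h; ordered_group.
Qed.

Lemma vsub_sound o k D q x : isZ x -> (zmod q %| D)%N ->
  (exists2 w, isZ w & x = one G *+ k + w *+ D) ->
  (forall p, p \in zcrit q ->
    ~ isL (x - pt p) /\ (tle (pt p) x <-> qeval ze fe (vge o p))) ->
  qeval (scons x ze) fe q <-> qeval ze fe (vsub o k q).
Proof.
move=> Zx; elim: q => // [t|m t|t|p IHp q IHq].
- rewrite [zcrit _]/= [qeval (scons _ _) _ _]/= [vsub _ _ _]/= => _ _.
  rewrite !leval_scons; case: lcoef0 => [[|n]|n] crit; first by rewrite mulr0z add0r.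
    by rewrite int_lower; case: (crit _ (mem_head _ _)).
  by rewrite int_upper //; case: (crit _ (mem_head _ _)) => _ ->.
- move=> /dvdnP[d ->] [w Zw ->] _ /=; rewrite leval_scons leval_add leval_const.
  set c := lcoef0 t; have cE : (one G *+ k + w *+ (d * m.+1)) *~ c + leval ze (lrest t) =
    leval ze (lrest t) + one G *~ (c * k) + (w *+ d) *~ c *+ m.+1.
    have -> : one G *~ (c * k) = one G *+ k *~ c by rewrite mulrC mulrzA.
    have -> : w *+ d *~ c *+ m.+1 = w *+ (d * m.+1) *~ c.
      by rewrite mulrnA !pmulrn mulrzAC.
    by rewrite mulrzDl addrAC [leval ze _ + _]addrC.
  rewrite cE; split=> -[v Zv vE].
    exists (v - (w *+ d) *~ c); first by apply: isZB => //; apply/isZMz/isZMn.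
    by rewrite mulrnBl -vE addrK.
  exists (v + (w *+ d) *~ c); first by apply: isZD => //; apply/isZMz/isZMn.
  by rewrite mulrnDl -vE.
- rewrite /= => _ _; rewrite !leval_scons; case: lcoef0 => [[|n]|n] crit.
  + by rewrite mulr0z add0r.
  + by rewrite isL_lower; case: (crit _ (mem_head _ _)).
  + by rewrite isL_upper; case: (crit _ (mem_head _ _)).
move=> D0 xk crit /=; rewrite IHp ?IHq //.
- exact: dvdn_trans (dvdn_mull _ (dvdnn _)) D0.
- by move=> r rq; apply: crit; rewrite mem_cat rq orbT.
- exact: dvdn_trans (dvdn_mulr _ (dvdnn _)) D0.
- by move=> r rp; apply: crit; rewrite mem_cat rp.
Qed.

(** First a [y] in the group is found at the place described by [o], away from all the cosets; then
    an integer of residue [k] is taken within distance [d.+1] of [y], which changes no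
    comparison. *)
Lemma virtual_point o k d (E : seq (nat * lterm)) : ~ (forall x : G, isL x) ->
  exists x, [/\ isZ x, exists2 w, isZ w & x = one G *+ k + w *+ d.+1 &
    forall p, p \in E -> ~ isL (x - pt p) /\ (tle (pt p) x <-> qeval ze fe (vge o p))].
Proof.
move=> nL; have [w0 nLw0] : exists w : G, ~ isL w by apply/existsNP.
have [w nLw w_gt0] : exists2 w : G, ~ isL w & tlt 0 w.
  case: (tlt_total 0 w0) => [|[e|]]; first by exists w0.
    by case: nLw0; rewrite -e; apply: isL0.
  by move=> h; exists (- w0); [rewrite isL_opp|ordered_group].
pose P r := qeval ze fe (vge o r).
have [y [y_lo y_hi]] : exists y,
    (forall p, o = Some p -> tlt (pt p) y /\ ~ isL (y - pt p)) /\
    (forall r, r \in E -> ~ P r -> tlt y (pt r) /\ ~ isL (pt r - y)).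
  have [hi|nohi] := EM (exists2 r, r \in E & ~ P r); last first.
    (* Nothing bounds [y] from above. For [None] the list [E] is then empty and 0 is an arbitrary
       choice. *)
    exists (if o is Some p then pt p + w else 0); split=> [p ->|r rE nPr].
      by split; [ordered_group|rewrite addrAC subrr add0r].
    by case: nohi; exists r.
  have [h [hE nPh hmin]] := min_ex pt hi.
  case: o @P nPh hmin {hi} => [p|] P nPh hmin.
    have {}nPh : ~ (tle (pt h) (pt p) \/ isL (pt p - pt h)) by rewrite -qeval_vge.
    have ph : tlt (pt p) (pt h).
      by apply: contrapT => h'; apply: nPh; left; ordered_group.
    have nLph : ~ isL (pt p - pt h) by move=> h'; apply: nPh; right.
    (* The midpoint of [p] and [h] is used; half of their distance is outside [L] because [L] is
       closed under doubling. *)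
    pose v := tdivS (pt h - pt p) 1; have vE : v *+ 2 = pt h - pt p by exact: tdivSK.
    have nLv : ~ isL v by move/(isLMn 2); rewrite vE -opprB isL_opp.
    have v0 : tlt 0 v by ordered_group.
    exists (pt p + v); split=> [_ [<-]|r rE nPr].
      by split; [ordered_group|rewrite addrAC subrr add0r].
    have hr := hmin r rE nPr; split; first by ordered_group.
    by move=> Lr; apply: nLv; apply: (isL_le Lr); ordered_group.
  exists (pt h - w); split=> // r rE nPr.
  have hr := hmin r rE nPr; split; first by ordered_group.
  by move=> Lr; apply: nLw; apply: (isL_le Lr); ordered_group.
have yP r : r \in E -> ~ isL (y - pt r) /\ (tle (pt r) y <-> P r).
  move=> rE; have [Pr|nPr] := EM (P r); last first.
    have [h1 h2] := y_hi r rE nPr; split; first by rewrite -isL_opp opprB.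
    by split=> // h3; ordered_group.
  case: o @P y_lo Pr {y_hi} => [p|] P // /(_ p erefl)[py nLpy] Pr.
  suff [h1 h2] : ~ isL (y - pt r) /\ tle (pt r) y by split.
  have [rp|Lpr] := (qeval_vge p r).1 Pr; split; try by ordered_group.
  - by move=> Lyr; apply: nLpy; apply: (isL_le Lyr); ordered_group.
  - move=> Lyr; apply: nLpy; rewrite (_ : y - pt p = (y - pt r) - (pt p - pt r)).
      exact: isLB.
    by ordered_group.
  - move=> yr; apply: nLpy; apply/isL_opp; rewrite opprB.
    apply: (@isL_convex _ (pt p - pt r) _ 0) => //; [exact: isL0|by ordered_group..].
have [v [Zv yv vy]] := isZ_window d y (isZMn k (isZ1 G)).
exists (one G *+ k - v *+ d.+1); split.
- by apply: isZB; apply: isZMn => //; apply: isZ1.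
- by exists (- v); rewrite ?mulNrn //; apply: isZN.
set x := _ - _ in yv vy *; move=> r rE; have [nLyr yr] := yP r rE.
have Lxy : isL (x - y).
  by apply: (isL_le (isLMn d.+1 (isL1 G))); ordered_group.
split; last exact: iff_trans (tle_coset Lxy nLyr) yr.
by rewrite -(subrKA y) addrC isL_addr.
Qed.

Lemma zelimP q : qeval ze fe (zelim q) <->
  exists2 x, isZ x & qeval (scons x ze) fe q.
Proof.
rewrite /zelim; set E := _ :: _; set D := zmod q.
have [d DE] : exists d, D = d.+1 by exists D.-1; rewrite prednK // zmod_gt0.
have critE p : p \in zcrit q -> p \in E by rewrite in_cons => ->; rewrite orbT.
rewrite qeval_Or qeval_And !qeval_Ors; split.
  case=> [[p _ /qeval_Ors[k _ /qeval_And[]]]|[nQL [o _ /qeval_Ors[k _ h]]]].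
    by move=> [x Zx xu] h; exists x => //; rewrite -(qeval_zsub _ (esym xu)).
  have [x [Zx xk xP]] := virtual_point o k d (zcrit q) nQL.
  by exists x => //; rewrite (vsub_sound (o := o) (k := k) (D := D)) // DE.
move=> [z Zz zq].
(* An integer within [D] of [p] that the atoms cannot tell from [z] is one of the tested points,
   with [k] the offset from [p - D] in units of [1 / p.1.+1]. *)
have near p x : p \in E -> isZ x -> (exists2 w, isZ w & x = z + w *+ D) ->
    tle (pt p - one G *+ D) x -> tlt x (pt p + one G *+ D) ->
    (forall r, r \in zcrit q ->
      (tle (pt r) x <-> tle (pt r) z) /\ (isL (x - pt r) <-> isL (z - pt r))) ->
    exists2 a, a \in E & qeval ze fe
      (QOrs [seq QAnd (QMod a.1 (ladd a.2 (lconst (k%:Z - (a.1.+1 * D)%N%:Z))))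
                      (zsub a.1 (ladd a.2 (lconst (k%:Z - (a.1.+1 * D)%N%:Z))) q)
            | k <- iota 0 (2 * (a.1.+1 * D))]).
  move=> pE Zx xz px xp agree; exists p => //; apply/qeval_Ors.
  have ptK : pt p *+ p.1.+1 = leval ze p.2 by exact: lpointK.
  move/(@tle_pMn2r _ p.1): px; rewrite mulrnBl ptK -mulrnA mulnC => px.
  move/(@tlt_pMn2r _ p.1): xp; rewrite mulrnDl ptK -mulrnA mulnC => xp.
  set M := (p.1.+1 * D)%N in px xp *.
  have [k kM kE] : exists2 k, (k < 2 * M)%N &
      x *+ p.1.+1 - leval ze p.2 + one G *+ M = one G *+ k.
    apply: isZ_numeral; last by rewrite mul2n -addnn [_ *+ (M + M)]mulrnDr; ordered_group.
      apply: isZD; last exact: isZMn (isZ1 G).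
      by apply: isZB; [exact: isZMn|exact: isZ_leval].
    by ordered_group.
  exists k; first by rewrite mem_iota.
  have xu : x *+ p.1.+1 = leval ze (ladd p.2 (lconst (k%:Z - M%:Z))).
    by rewrite leval_add leval_const mulrzBr -!pmulrn -kE; ordered_group.
  rewrite qeval_And (qeval_zsub _ xu); split; first by exists x.
  by rewrite (@zcrit_sound D _ x z).
have [[p0 p0E Lp0]|far] := EM (exists2 p, p \in E & isL (z - pt p)).
  left.
  (* Such a move stays in the coset of [z], so only comparisons with critical points of this coset
     need checking. *)
  have nearL p w : p \in E -> isL (z - pt p) -> isZ w ->
      tle (pt p - one G *+ D) (z - w *+ D) -> tlt (z - w *+ D) (pt p + one G *+ D) ->
      (forall r, r \in E -> isL (z - pt r) -> tle (pt r) (z - w *+ D) <-> tle (pt r) z) ->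
      exists2 a, a \in E & qeval ze fe
      (QOrs [seq QAnd (QMod a.1 (ladd a.2 (lconst (k%:Z - (a.1.+1 * D)%N%:Z))))
                      (zsub a.1 (ladd a.2 (lconst (k%:Z - (a.1.+1 * D)%N%:Z))) q)
            | k <- iota 0 (2 * (a.1.+1 * D))]).
    move=> pE Lp Zw px xp le; apply: (near p _ pE _ _ px xp).
    - exact: isZB Zz (isZMn _ Zw).
    - by exists (- w); rewrite ?mulNrn //; apply: isZN.
    have Lxp : isL (z - w *+ D - pt p).
      have LD : isL (one G *+ D) by apply: isLMn (isL1 G).
      by apply: (isL_convex (isLN LD) LD); ordered_group.
    have Lxz : isL (z - w *+ D - z).
      rewrite (_ : _ - z = (z - w *+ D - pt p) - (z - pt p)); first exact: isLB.
      by ordered_group.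
    move=> r /critE rE.
    have Lxr : isL (z - w *+ D - pt r) <-> isL (z - pt r).
      rewrite (_ : _ - pt r = (z - pt r) + (z - w *+ D - z)); first exact: isL_addr.
      by ordered_group.
    split=> //; have [Lr|nLr] := EM (isL (z - pt r)); first exact: le.
    exact: tle_coset.
  (* If the coset has critical points up to [z], then [z] is moved down to the window just above the
     largest of them; otherwise to the window just below the smallest critical point of the
     coset. *)
  have [below|nobelow] := EM (exists2 p, p \in E & isL (z - pt p) /\ tle (pt p) z).
    have [p [pE [Lp pz] pmax]] := max_ex pt below.
    have [w [Zw h1 h2]] := isZ_window d (pt p) Zz; rewrite -DE in h1 h2.
    have o0 : tle 0 (one G *+ D) by exact: one_ge0.
    have w0 : tle 0 (w *+ D).
      have w1 : tlt (- w) (0 + one G).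
        by apply/(@tlt_pMn2r _ d); rewrite -DE add0r mulNrn; ordered_group.
      have w2 := isZ_ltS (isZN Zw) (isZ0 G) w1.
      rewrite DE -[X in tle X _](mul0rn _ d.+1); apply/tle_pMn2r; ordered_group.
    apply: (nearL p w pE Lp Zw _ h2); first by ordered_group.
    move=> r rE Lr; split=> h; first by ordered_group.
    by have h3 := pmax r rE (conj Lr h); ordered_group.
  have [p [pE Lp pmin]] : exists p, [/\ p \in E, isL (z - pt p) &
      forall r, r \in E -> isL (z - pt r) -> tle (pt p) (pt r)].
    by apply: min_ex; exists p0.
  have above r : r \in E -> isL (z - pt r) -> tlt z (pt r).
    by move=> rE Lr; apply: contrapT => h; apply: nobelow; exists r.
  have [w [Zw h1 h2]] := isZ_window d (pt p - one G *+ D) Zz; rewrite -DE in h1 h2.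
  have zp := above p pE Lp.
  have o0 : tle 0 (one G *+ D) by exact: one_ge0.
  apply: (nearL p w pE Lp Zw h1); first by ordered_group.
  move=> r rE Lr; have zr := above r rE Lr; have pr := pmin r rE Lr.
  by split=> h; ordered_group.
right; split.
  move=> QL; apply: far; exists (0%N, lconst 0); [exact: mem_head|exact: QL].
have [w [Zw h1 h2]] := isZ_window d 0 Zz; rewrite -DE in h1 h2.
have [k kD kE] : exists2 k, (k < D)%N & z - w *+ D = one G *+ k.
  by apply: isZ_numeral => //; [exact: isZB Zz (isZMn _ Zw)|ordered_group].
have zk : exists2 w, isZ w & z = one G *+ k + w *+ D.
  by exists w => //; rewrite -kE subrK.
(* The virtual point of [z] is given by the largest critical point below it, or is -oo. A critical
   point above [z] but in the coset of [p] would by convexity put [z] in that coset. *)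
have [o oE oP] : exists2 o, o \in None :: map some E &
    forall r, r \in E -> tle (pt r) z <-> qeval ze fe (vge o r).
  have [below|nobelow] := EM (exists2 p, p \in E & tle (pt p) z); last first.
    exists None; first exact: mem_head.
    by move=> r rE; split=> // h; apply: nobelow; exists r.
  have [p [pE pz pmax]] := max_ex pt below.
  exists (Some p); first by rewrite in_cons map_f.
  move=> r rE; rewrite qeval_vge; split=> [h|[h|Lpr]]; first by left; apply: pmax.
    by ordered_group.
  apply: contrapT => zr; apply: far; exists p => //.
  rewrite -opprB in Lpr; move/isL_opp in Lpr.
  by apply: (isL_le Lpr); ordered_group.
exists o => //; apply/qeval_Ors; exists k; first by rewrite mem_iota.
rewrite -(vsub_sound (D := D) (x := z)) // => p /critE pE; split; last exact: oP.
by move=> Lp; apply: far; exists p.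
Qed.

End IntElimination.

(** * From formulas to two-sorted conditions and back *)

Fixpoint tlin (t : term) : lterm :=
  match t with
  | Var i => ([:: (1, i)], 0)
  | Zero => lconst 0
  | One => lconst 1
  | Add s t => ladd (tlin s) (tlin t)
  end.

(** Bounds the absolute value of the linear combination on arguments in [[0, 1)]. *)
Definition lbound (s : seq (int * nat)) : nat := sumn [seq `|p.1|%N | p <- s].

(* As the integer part of [t] is a sum of floors, [0 <= t] only depends on the
   floor [k - lbound t.1] of the sum of the fractional parts. *)
Definition qge (t : lterm) : qf :=
  QOrs [seq QAnd (QAnd (QFrac (t.1, (lbound t.1)%:Z - k%:Z))
                       (QNot (QFrac (t.1, (lbound t.1)%:Z - k%:Z - 1))))
                 (QInt (t.1, t.2 + (k%:Z - (lbound t.1)%:Z)))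
       | k <- iota 0 (lbound t.1).*2.+1].

(** Floors and constant contribute an integer, so the sum of the fractional parts must equal one of
    the integers in its range. *)
Definition qinZ (t : lterm) : qf :=
  QOrs [seq QAnd (QFrac (t.1, (lbound t.1)%:Z - k%:Z))
                 (QFrac (lscale (-1) (t.1, (lbound t.1)%:Z - k%:Z)))
       | k <- iota 0 (lbound t.1).*2.+1].

(** A quantified element is a pair of a floor and a fractional part, eliminated one after the other.
    Membership in [L] only sees the floors. *)
Fixpoint compile (p : form) : qf :=
  match p with
  | Eq s t => QAnd (qge (ladd (tlin s) (lscale (-1) (tlin t))))
                   (qge (ladd (tlin t) (lscale (-1) (tlin s))))
  | Lt s t => QNot (qge (ladd (tlin s) (lscale (-1) (tlin t))))
  | InZ t => qinZ (tlin t)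
  | InL t => QL (tlin t)
  | Bot => QBot
  | Imp p q => QImp (compile p) (compile q)
  | All p => QNot (zelim (felim (QNot (compile p))))
  end.

Section Compile.

Variable G : tgroup.
Implicit Types (x : G) (e : nat -> G).

Definition tfrac x : G := x - tfloor x.

Lemma tfrac_ge0 x : tle 0 (tfrac x).
Proof. by have [_ h1 h2] := tfloorP x; rewrite /tfrac; ordered_group. Qed.

Lemma tfrac_lt1 x : tlt (tfrac x) (one G).
Proof. by have [_ h1 h2] := tfloorP x; rewrite /tfrac; ordered_group. Qed.

Lemma isL_frac x : isL (tfrac x).
Proof.
have h0 : tle 0 (tfrac x) by exact: tfrac_ge0.
 have h1 := tfrac_lt1 x.
by apply: (isL_le (isL1 G)); ordered_group.
Qed.

Lemma tval_lin e t : tval (M := tgroup_structure G) e t = leval e (tlin t).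
Proof.
elim: t => [i|||s IHs t IHt] /=; rewrite ?leval_const //.
- by rewrite /leval /= mulr0z mulr1z !addr0.
- by rewrite leval_add IHs IHt.
Qed.

Lemma lsum_floor_frac e s :
  lsum e s = lsum (@tfloor G \o e) s + lsum (tfrac \o e) s.
Proof.
elim: s => [|[k i] s IH] /=; first by rewrite addr0.
by rewrite IH [RHS]addrACA -mulrzDl /tfrac [tfloor _ + _]addrC subrK.
Qed.

Lemma leval_floor_frac e t :
  leval e t = leval (@tfloor G \o e) t + lsum (tfrac \o e) t.1.
Proof. by rewrite /leval lsum_floor_frac addrAC. Qed.

Lemma isL_lsum e s : (forall i, isL (e i)) -> isL (lsum e s).
Proof.
move=> Le; elim: s => [|[k i] s IH] /=; first exact: isL0.
by apply: isLD => //; apply: isLMz.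
Qed.

Lemma lsum_bound e s : (forall i, tle 0 (e i)) -> (forall i, tlt (e i) (one G)) ->
  tle (- (one G *+ lbound s)) (lsum e s) /\ tle (lsum e s) (one G *+ lbound s).
Proof.
move=> e0 e1; elim: s => [|[k i] s [IH1 IH2]].
  by rewrite /= mulr0n; split; ordered_group.
rewrite [lbound _]/(`|k| + lbound s)%N mulrnDr /=.
have ek n : tle 0 (e i *+ n) /\ tle (e i *+ n) (one G *+ n).
  elim: n => [|n [IHn1 IHn2]]; first by rewrite !mulr0n; split; exact: tle_refl.
  by have h0 := e0 i; have h1 := e1 i; rewrite !mulrS; split; ordered_group.
case: k => n; [have [h1 h2] := ek n|have [h1 h2] := ek n.+1].
  by rewrite -pmulrn absz_nat; split; ordered_group.
by rewrite NegzE mulrNz -pmulrn abszN absz_nat; split; ordered_group.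
Qed.

Lemma lsum_window e s : (forall i, tle 0 (e i)) -> (forall i, tlt (e i) (one G)) ->
  exists2 k, k \in iota 0 (lbound s).*2.+1 &
    tfloor (lsum e s) = one G *~ (k%:Z - (lbound s)%:Z).
Proof.
move=> e0 e1; have [h1 h2] := lsum_bound s e0 e1.
have [Zf f1 f2] := tfloorP (lsum e s); have o0 := one_gt0 G.
have [k kB kE] : exists2 k, (k < (lbound s).*2.+1)%N &
    tfloor (lsum e s) + one G *+ lbound s = one G *+ k.
  apply: isZ_numeral.
  - by apply: isZD => //; apply: isZMn; exact: isZ1.
  - suff : tle (- (one G *+ lbound s)) (tfloor (lsum e s)) by move=> h; ordered_group.
    apply: isZ_ltS => //; last by ordered_group.
    by apply/isZN/isZMn/isZ1.
  - by rewrite -addnn mulrS mulrnDr; ordered_group.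
exists k; first by rewrite mem_iota.
by rewrite mulrzBr -!pmulrn -kE addrK.
Qed.

Section Atoms.

Variable e : nat -> G.
Let ze := @tfloor G \o e.
Let fe := tfrac \o e.

Let Zze i : isZ (ze i).
Proof. by have [] := tfloorP (e i). Qed.

Let fe0 i : tle 0 (fe i). Proof. exact: tfrac_ge0. Qed.

Let fe1 i : tlt (fe i) (one G). Proof. exact: tfrac_lt1. Qed.

Lemma tfloor_intP x (k : int) : tfloor x = one G *~ k <->
  tle (one G *~ k) x /\ tlt x (one G *~ k + one G).
Proof.
split=> [<-|[h1 h2]]; first by have [] := tfloorP x.
by apply: tfloor_unique => //; apply: isZMz; exact: isZ1.
Qed.

Lemma qge_sound t : qeval ze fe (qge t) <-> tle 0 (leval e t).
Proof.
rewrite leval_floor_frac -/ze -/fe /qge qeval_Ors; set F := lsum fe t.1.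
set B := lbound t.1.
have iffk k : qeval ze fe (QAnd (QAnd (QFrac (t.1, B%:Z - k%:Z))
      (QNot (QFrac (t.1, B%:Z - k%:Z - 1)))) (QInt (t.1, t.2 + (k%:Z - B%:Z)))) <->
    tfloor F = one G *~ (k%:Z - B%:Z) /\ tle 0 (leval ze t + one G *~ (k%:Z - B%:Z)).
  rewrite !qeval_And tfloor_intP /= /leval /= !mulrzDr !mulrNz -/F.
  split=> [[[h1 h2] h3]|[[h1 h2] h3]]; rewrite ?mulr1z in h1 h2 h3 *.
    by do !split; ordered_group.
  by do !split; try move=> h4; ordered_group.
have Zz := isZ_leval t Zze; have [Zf f1 f2] := tfloorP F.
split=> [[k _ /iffk[kE h]]|h].
  by rewrite kE in f1 f2; ordered_group.
have [k kB kE] := lsum_window t.1 fe0 fe1.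
exists k => //; apply/iffk; split=> //; rewrite -kE -/F.
(* The other summand is in [Z], so [F] may be replaced by its floor. *)
by apply: isZ_ltS; [exact: isZ0|exact: isZD|ordered_group].
Qed.

Lemma qinZ_sound t : qeval ze fe (qinZ t) <-> isZ (leval e t).
Proof.
rewrite leval_floor_frac -/ze -/fe /qinZ qeval_Ors; set F := lsum fe t.1.
set B := lbound t.1.
have iffk k : qeval ze fe (QAnd (QFrac (t.1, B%:Z - k%:Z))
      (QFrac (lscale (-1) (t.1, B%:Z - k%:Z)))) <-> F = one G *~ (k%:Z - B%:Z).
  rewrite qeval_And [qeval _ _ (QFrac (lscale _ _))]/= leval_scale /= /leval /=.
  rewrite mulrN1z !mulrzDr !mulrNz -/F.
  by split=> [[h1 h2]|h]; [ordered_group|split; ordered_group].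
have Zz := isZ_leval t Zze.
split=> [[k _ /iffk ->]|h]; first by apply: isZD => //; apply: isZMz; exact: isZ1.
have [k kB kE] := lsum_window t.1 fe0 fe1; exists k => //; apply/iffk.
rewrite -kE -/F; apply/esym/tfloor_unique.
- by rewrite -[F](addKr (leval ze t)) addrC; apply: isZB.
- exact: tle_refl.
- by have o0 := one_gt0 G; ordered_group.
Qed.

End Atoms.

Lemma compileP p e : sat (M := tgroup_structure G) e p <->
  qeval (@tfloor G \o e) (tfrac \o e) (compile p).
Proof.
elim: p e => [s t|s t|t|t||p IHp q IHq|p IHp] e; rewrite [compile _]/= [sat _ _]/=.
- rewrite qeval_And !qge_sound !leval_add !leval_scale !tval_lin mulrN1z.
  by rewrite mulrN1z; split=> [->|[h1 h2]]; [split|]; ordered_group.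
- rewrite qeval_Not qge_sound leval_add leval_scale !tval_lin mulrN1z.
  by split=> h; [move=> h'|]; ordered_group.
- by rewrite qinZ_sound tval_lin.
- rewrite tval_lin leval_floor_frac isL_addr //.
  by apply: isL_lsum => i; apply: isL_frac.
- by [].
- by rewrite IHp IHq.
have Zze i : isZ ((@tfloor G \o e) i) by have [] := tfloorP (e i).
rewrite qeval_Not (zelimP _ Zze); split=> [h [z Zz /felimP[x [x0 x1 nq]]]|h x].
  (* Any [z] in [Z] and [x] in [[0, 1)] are the floor and the fractional part of [z + x]. *)
  apply: nq; have zx : tfloor (z + x) = z by apply: tfloor_unique => //; ordered_group.
  have := (IHp _).1 (h (z + x)).
  congr qeval; apply: funext => -[|i] //=; rewrite ?zx //.
  by rewrite /tfrac zx addrC addKr.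
apply: contrapT => np; apply: h; have [Zx h1 h2] := tfloorP x.
exists (tfloor x) => //; apply/felimP; exists (tfrac x); split.
- exact: tfrac_ge0.
- exact: tfrac_lt1.
move=> hq; apply: np; apply/IHp; move: hq; congr qeval; apply: funext => -[|i] //.
Qed.

(** * Values of extended terms and of the special atoms *)

Fixpoint xval e (a : xterm) : G :=
  match a with
  | XVar i => e i
  | XZero => 0
  | XOne => one G
  | XAdd a b => xval e a + xval e b
  | XOpp a => - xval e a
  | XFloor a => tfloor (xval e a)
  end.

Let S := tgroup_structure G.

Lemma tval_shift e x t : tval (M := S) (scons x e) (tsubst shift t) = tval (M := S) e t.
Proof. by elim: t => //= s -> t ->. Qed.

Lemma value_isP k a t e :
  sat (M := S) e (value_is k a t) <-> tval (M := S) e t = xval (fun i => e (k + i)%N) a.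
Proof.
elim: a k t e => [i|||a IHa b IHb|a IHa|a IHa] k t e; rewrite ?[value_is _ _ _]/=.
- by [].
- by [].
- by [].
- rewrite sat_Ex; split=> [[x /sat_Ex[y]]|h].
    rewrite !sat_And IHa IHb => -[hx [hy]].
    rewrite /= !tval_shift => ->.
    have {hx} -> : x = xval (fun i => e (k + i)%N) a := hx.
    by have {hy} -> : y = xval (fun i => e (k + i)%N) b := hy.
  exists (xval (fun i => e (k + i)%N) a); apply/sat_Ex.
  exists (xval (fun i => e (k + i)%N) b).
  by rewrite !sat_And IHa IHb /= !tval_shift.
- rewrite sat_Ex; split=> [[x]|h].
    rewrite sat_And IHa => -[hx]; rewrite /= tval_shift => h; rewrite -[X in - X]hx /=.
    by apply/eqP; rewrite -addr_eq0; apply/eqP.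
  exists (xval (fun i => e (k + i)%N) a); rewrite sat_And IHa; split=> //=.
  by rewrite tval_shift h /= addNr.
rewrite sat_Ex; split=> [[x]|h].
  rewrite !sat_And IHa => -[hx [Zt [ht1 ht2]]] /=.
  have {hx} <- : x = xval (fun i => e (k + i)%N) a := hx.
  move: Zt ht2 ht1; rewrite /= tval_shift => Zt ht2 ht1; apply/esym/tfloor_unique => //.
  by apply/tle_eqVlt; have [|] := EM (tlt (tval (M := S) e t) x); [left|move/ht1; right].
have [Zf h1 h2] := tfloorP (xval (fun i => e (k + i)%N) a).
exists (xval (fun i => e (k + i)%N) a); rewrite !sat_And IHa; split=> //=.
rewrite tval_shift h /=; do !split => //.
by move=> h3; case/tle_eqVlt: h1.
Qed.

Lemma xval_Mulz e n a : xval e (XMulz n a) = xval e a *~ n.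
Proof.
have aux m : xval e (iter m (XAdd a) XZero) = xval e a *+ m.
  by elim: m => // m /= ->; rewrite mulrS.
by case: n => m; [exact: aux|exact: (congr1 -%R (aux m.+1))].
Qed.

Lemma xval_Int e n : xval e (XInt n) = one G *~ n.
Proof. exact: xval_Mulz. Qed.

Lemma xval_lincomb e f s :
  xval e (lincomb f s) = lsum (fun i => xval e (f (XVar i))) s.
Proof. by elim: s => //= p s IH; rewrite xval_Mulz IH. Qed.

Lemma sat_xge e a b : sat (M := S) e (xge a b) <-> tle (xval e b) (xval e a).
Proof.
rewrite sat_Ex; split=> [[x /sat_Ex[y]]|h].
  rewrite !sat_And !value_isP /= => -[-> [->]] h; apply/tle_eqVlt.
  by have [|/h] := EM (tlt (xval e b) (xval e a)); [left|right].
exists (xval e a); apply/sat_Ex; exists (xval e b).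
rewrite !sat_And !value_isP; do !split => //.
by move=> h3; case/tle_eqVlt: h => // h; case: (h3 h).
Qed.

Lemma sat_xinL e a : sat (M := S) e (xinL a) <-> isL (xval e a).
Proof.
rewrite sat_Ex; split=> [[x]|h]; first by rewrite sat_And value_isP /= => -[->].
by exists (xval e a); rewrite sat_And value_isP.
Qed.

Lemma sat_xeqmod e m a b : sat (M := S) e (xeqmod m a b) <->
  exists2 w, isZ w & xval e a - xval e b = w *+ m.
Proof.
have tm x w : tval (M := S) (scons w (scons x e)) (tmuln m (Var 0)) = w *+ m.
  by rewrite tval_tmuln /=; elim: m => // m IH; rewrite mulrS iterS IH.
rewrite sat_Ex; split=> [[x /sat_Ex[w]]|[w Zw h]].
  rewrite !sat_And value_isP => -[hx [Zw xw]]; exists w => //.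
  rewrite -(tm x w) -[RHS]xw; exact: (esym hx).
exists (w *+ m); apply/sat_Ex; exists w; rewrite !sat_And value_isP /= -h; do !split => //.
by rewrite tm.
Qed.

End Compile.

(** * Translation back into special formulas *)

Definition Ors (ps : seq form) : form := foldr Or Bot ps.

(** Special congruences concern a single floor, so the residue [r] of each variable is guessed in
    turn and accumulated in [k]; a congruence between numerals remains, replaced by its truth
    value. *)
Fixpoint modform (m : nat) (s : seq (int * nat)) (k : int) : form :=
  if s is p :: s then
    Ors [seq And (xeqmod m.+1 (XFloor (XVar p.2)) (XInt (Posz r)))
                 (modform m s (k + p.1 * r%:Z)) | r <- iota 0 m.+1]
  else if (m.+1%:Z %| k)%Z then Imp Bot Bot else Bot.

Fixpoint decompile (q : qf) : form :=
  match q with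
  | QFrac t => xge (lincomb XFrac t.1) (XInt (- t.2))
  | QInt t => xge (lincomb XFloor t.1) (XInt (- t.2))
  | QMod m t => modform m t.1 t.2
  | QL t => xinL (lincomb id t.1)
  | QAllL => All (InL (Var 0))
  | QBot => Bot
  | QImp p q => Imp (decompile p) (decompile q)
  end.

Lemma special_Ors (T : eqType) (f : T -> form) s :
  (forall a, a \in s -> special (f a)) -> special (Ors [seq f a | a <- s]).
Proof.
elim: s => [|a s IH] sf; first exact: special_Bot.
apply: special_Imp; last by apply: IH => b bs; apply: sf; rewrite in_cons bs orbT.
by apply: special_Imp; [apply: sf; exact: mem_head|exact: special_Bot].
Qed.

Lemma special_decompile q : special (decompile q).
Proof.
elim: q => [t|t|m [s k]|t|||p IHp q IHq] /=; try by constructor.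
elim: s k => [|p s IH] k; first by rewrite /=; case: ifP => _; repeat constructor.
apply: (@special_Ors _ (fun r => And (xeqmod m.+1 (XFloor (XVar p.2)) (XInt (Posz r)))
  (modform m s (k + p.1 * r%:Z)))) => r; rewrite mem_iota => /andP[_ rm].
by repeat constructor.
Qed.

Section Decompile.

Variables (G : tgroup) (e : nat -> G).
Let S := tgroup_structure G.

Lemma sat_Ors (T : eqType) (f : T -> form) s :
  sat (M := S) e (Ors [seq f a | a <- s]) <-> exists2 a, a \in s & sat (M := S) e (f a).
Proof.
elim: s => [|a s IH]; first by split=> // -[].
rewrite [Ors _]/(Or (f a) (Ors [seq f b | b <- s])) sat_Or IH; split.
  by move=> [h|[b bs h]]; [exists a; rewrite ?mem_head|exists b; rewrite ?in_cons ?bs ?orbT].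
by move=> [b]; rewrite in_cons => /predU1P[->|bs]; [left|right; exists b].
Qed.

(** The quotient in [Z] might be nonstandard, but after division of [k] by [m.+1] what is left of it
    has a multiple in [[0, m.+1)], hence vanishes by discreteness. *)
Lemma one_dvd m (k : int) :
  (m.+1%:Z %| k)%Z <-> exists2 w : G, isZ w & one G *~ k = w *+ m.+1.
Proof.
split=> [/dvdzP[j ->]|[w Zw]].
  by exists (one G *~ j); [exact: isZMz (isZ1 G)|rewrite mulrzA].
rewrite {1}(divz_eq k m.+1); set q := (k %/ _)%Z.
have [r rE rm] : exists2 r, (k %% m.+1)%Z = Posz r & (r < m.+1)%N.
  have := modz_ge0 k (isT : m.+1%:Z != 0); have := ltz_mod k (isT : m.+1%:Z != 0).
  by case: (k %% m.+1)%Z => // r rm _; exists r.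
rewrite rE mulrzDr mulrzA -!pmulrn => E.
pose v := w - one G *~ q.
have Zv : isZ v by apply: isZB => //; exact: isZMz (isZ1 G).
have vE : v *+ m.+1 = one G *+ r by rewrite mulrnBl -E addrC addKr.
have v0 : v = 0.
  apply: tle_anti.
    apply: isZ_ltS => //; first exact: isZ0.
    apply/(@tlt_pMn2r _ m); rewrite vE add0r.
    have -> : m.+1 = (r + (m - r).+1)%N by lia.
    rewrite mulrnDr mulrS; have h0 : tle 0 (one G *+ (m - r)) by exact: one_ge0.
    have h1 := one_gt0 G.
    by ordered_group.
  by apply/(@tle_pMn2r _ m); rewrite vE mul0rn; exact: one_ge0.
apply/dvdz_mod0P; rewrite rE; case: r vE {rE rm E} => // r.
rewrite v0 mul0rn mulrS => E; have h0 : tle 0 (one G *+ r) by exact: one_ge0.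
 have h1 := one_gt0 G.
by exfalso; ordered_group.
Qed.

Lemma modformP m s k : sat (M := S) e (modform m s k) <->
  exists2 w, isZ w & lsum (@tfloor G \o e) s + one G *~ k = w *+ m.+1.
Proof.
elim: s k => [|[a i] s IH] k.
  have -> : (exists2 w : G, isZ w & lsum (@tfloor G \o e) [::] + one G *~ k = w *+ m.+1)
      <-> (m.+1%:Z %| k)%Z.
    by rewrite one_dvd; split=> -[w Zw h]; exists w; rewrite // ?add0r // -h add0r.
  by rewrite [modform _ _ _]/=; case: ifP => _ /=; split.
apply: iff_trans (sat_Ors (fun r => And (xeqmod m.+1 (XFloor (XVar i)) (XInt (Posz r)))
  (modform m s (k + a * r%:Z))) (iota 0 m.+1)) _.
have Zi : isZ (tfloor (e i)) by have [] := tfloorP (e i).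
(* With a correct residue [r], the summand [a] times the floor may be replaced by [a * r]. *)
have step r : (exists2 v, isZ v & tfloor (e i) - one G *+ r = v *+ m.+1) ->
    ((exists2 w, isZ w & lsum (@tfloor G \o e) ((a, i) :: s) + one G *~ k = w *+ m.+1)
     <-> sat (M := S) e (modform m s (k + a * r%:Z))).
  move=> [v Zv vE]; rewrite IH.
  have -> : lsum (@tfloor G \o e) ((a, i) :: s) + one G *~ k =
      lsum (@tfloor G \o e) s + one G *~ (k + a * r%:Z) + v *~ a *+ m.+1.
    have -> : v *~ a *+ m.+1 = v *+ m.+1 *~ a by rewrite !pmulrn mulrzAC.
    rewrite -vE mulrzDr [a * _]mulrC mulrzA -pmulrn mulrzBl /=.
    by ordered_group.
  split=> -[w Zw wE].
    exists (w - v *~ a); first by apply: isZB => //; exact: isZMz.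
    by rewrite mulrnBl -wE addrK.
  exists (w + v *~ a); first by apply: isZD => //; exact: isZMz.
  by rewrite mulrnDl -wE.
split=> [[r _ /sat_And[/sat_xeqmod]]|h].
  by rewrite xval_Int /= => hr; rewrite -step.
have [w [Zw h1 h2]] := isZ_window m 0 Zi.
have [r rm rE] : exists2 r, (r < m.+1)%N & tfloor (e i) - w *+ m.+1 = one G *+ r.
  by apply: isZ_numeral => //; [exact: isZB Zi (isZMn _ Zw)|ordered_group].
have hr : exists2 v, isZ v & tfloor (e i) - one G *+ r = v *+ m.+1.
  by exists w => //; rewrite -rE opprB addrC subrK.
exists r; first by rewrite mem_iota.
by apply/sat_And; rewrite -step // sat_xeqmod xval_Int.
Qed.

Lemma decompileP q : sat (M := S) e (decompile q) <->
  qeval (@tfloor G \o e) (tfrac (G := G) \o e) q.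
Proof.
elim: q => [t|t|m t|t|||p IHp q IHq]; rewrite [decompile _]/=.
- rewrite sat_xge xval_Int xval_lincomb mulrNz /= /leval.
  by split=> h; ordered_group.
- rewrite sat_xge xval_Int xval_lincomb mulrNz /= /leval.
  by split=> h; ordered_group.
- exact: modformP.
(* The constant and the fractional parts lie in [L], so the special atom may drop the former and
   restore the latter. *)
- rewrite sat_xinL xval_lincomb /= /leval isL_addr; last exact: isLMz (isL1 G).
  rewrite [lsum _ _](lsum_floor_frac e) isL_addr //.
  by apply: isL_lsum => i; apply: isL_frac.
- by [].
- by [].
- by rewrite /= IHp IHq.
Qed.

End Decompile.

Theorem theorem4p4 (phi : form) :
  exists2 psi : form, special psi & provable three_groups (Iff phi psi).
Proof.
exists (decompile (compile phi)); first exact: special_decompile.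
apply: (completeness three_groups_closed) => M e /(@model_tgroup M)[G MG].
move: e; rewrite MG => e; apply/sat_And.
by split; [move/compileP/decompileP|move/decompileP/compileP].
Qed.
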